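(* Let $R$ be a $\mathbb{Z}$-graded ring which is left and right artinian. Then: (1) every finitely generated right $R$-module is gradable if and only if every finitely generated left $R$-module is gradable; (2) there is a bound on the graded lengths of the finitely generated indecomposable graded right $R$-modules if and only if there is a bound on the graded lengths of the finitely generated indecomposable graded left $R$-modules.
   Context: A graded right $R$-module is $M=\bigoplus_{n\in\mathbb{Z}}M_n$ with $M_iR_j\subseteq M_{i+j}$; similarly for left modules. Morphisms of graded modules are $R$-linear maps preserving degrees, and a graded module is indecomposable if it is so in the category of graded modules. The graded length of a nonzero graded module $M$ is $\sup\{n\mid M_n\neq0\}-\inf\{n\mid M_n\neq0\}+1$. A (left or right) module is gradable if it is isomorphic to the underlying module of some graded module. *)

(* Defs.v *)
From HB Require Import structures.
From mathcomp Require Import all_boot all_order all_algebra.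
From mathcomp Require Import all_classical constructive_ereal.

Set Implicit Arguments.
Unset Strict Implicit.
Unset Printing Implicit Defensive.

Import Order.TTheory GRing.Theory Num.Theory.
Local Open Scope classical_set_scope.
Local Open Scope ring_scope.

(* Subsets are Prop-valued ([set V]); [x \in A] is their (classically decided)
   boolean membership, so that the closure predicates of ssralg apply.

   A right R-module is a left module over the converse ring: an [lmodType R^c],
   in which the right action of [r : R] on [x] is [(r : R^c) *: x]. *)

(* V is the internal direct sum of the subgroups Vg n: they span V and are
   independent. *)
Definition is_grading (V : zmodType) (Vg : int -> set V) : Prop :=
  [/\ forall n, zmod_closed [in Vg n],
      forall x, exists s : seq int, exists f : int -> V,
        [/\ uniq s, forall n, f n \in Vg n & x = \sum_(n <- s) f n]
    & forall (s : seq int) (f : int -> V), uniq s ->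
        (forall n, f n \in Vg n) -> \sum_(n <- s) f n = 0 ->
        forall n, n \in s -> f n = 0].

(* That 1 has degree 0 is a consequence. Multiplication in R^c being reversed,
   a grading of R is also one of R^c. *)
Definition is_graded_ring (R : pzRingType) (Rg : int -> set R) : Prop :=
  is_grading Rg /\
  forall i j r r', r \in Rg i -> r' \in Rg j -> r * r' \in Rg (i + j).

Section Modules.
Variable R : pzRingType.

Definition artinian_module (M : lmodType R) : Prop :=
  forall I : nat -> set M,
    (forall n, submod_closed [in I n]) -> (forall n, I n.+1 `<=` I n) ->
    exists n, forall m, (n <= m)%N -> I m = I n.

Definition finitely_generated (M : lmodType R) : Prop :=
  exists (n : nat) (g : 'I_n -> M),
    forall x, exists c : 'I_n -> R, x = \sum_(i < n) c i *: g i.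

End Modules.

Definition left_artinian (R : pzRingType) : Prop := artinian_module R^o.
Definition right_artinian (R : pzRingType) : Prop := left_artinian R^c.

Section GradedModules.
Variables (R : pzRingType) (Rg : int -> set R).

Definition is_graded_module (M : lmodType R) (Mg : int -> set M) : Prop :=
  is_grading Mg /\
  forall i j x r, x \in Mg i -> r \in Rg j -> r *: x \in Mg (i + j).

Record gradedModule := GradedModule {
  gmodule :> lmodType R;
  gcomp : int -> set gmodule;
  gmoduleP : is_graded_module gcomp
}.
Arguments gcomp : clear implicits.

Definition graded_morphism (M N : gradedModule) (f : {linear M -> N}) : Prop :=
  forall n x, x \in gcomp M n -> f x \in gcomp N n.

Definition graded_isomorphic (M N : gradedModule) : Prop :=
  exists (f : {linear M -> N}) (g : {linear N -> M}),
    [/\ graded_morphism f, graded_morphism g, cancel f g & cancel g f].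

Lemma graded_dsum_subproof (M N : gradedModule) :
  @is_graded_module (M * N)%type
    (fun n => [set x | x.1 \in gcomp M n /\ x.2 \in gcomp N n]).
Proof.
case: (gmoduleP M) => -[cM sM iM] aM; case: (gmoduleP N) => -[cN sN iN] aN.
have sumE (s : seq int) (f : int -> (M * N)%type) :
    \sum_(n <- s) f n = (\sum_(n <- s) (f n).1, \sum_(n <- s) (f n).2).
  elim: s => [|n s IHs]; first by rewrite !big_nil.
  by rewrite !big_cons IHs.
have padE (V : zmodType) (s t : seq int) (f : int -> V) :
    uniq s -> uniq t -> {subset s <= t} ->
    \sum_(n <- t) (if n \in s then f n else 0) = \sum_(n <- s) f n.
  move=> us ut st; rewrite -big_mkcond -big_filter; apply: perm_big.
  apply: uniq_perm => //; first exact: filter_uniq.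
  by move=> n; rewrite mem_filter; case: (boolP (n \in s)) => // /st.
split; first split.
- move=> n; split; first by rewrite inE /=; case: (cM n) (cN n) => -> _ [-> _].
  move=> x y; rewrite !inE /= => -[x1 x2] [y1 y2].
  by split; [apply: (cM n).2 | apply: (cN n).2].
- move=> [x y]; have [s [f [us fM ->]]] := sM x.
  have [t [g [ut gN ->]]] := sN y.
  exists (undup (s ++ t)).
  exists (fun n => (if n \in s then f n else 0, if n \in t then g n else 0)).
  split; [exact: undup_uniq| |].
    move=> n; rewrite inE /=; split; case: ifP => // _.
      exact: (cM n).1.
    exact: (cN n).1.
  rewrite sumE /= !padE ?undup_uniq // => n; rewrite mem_undup mem_cat => ->//.
  by rewrite orbT.
- move=> s f us fMN; rewrite sumE => -[s1 s2] n ns.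
  rewrite [f n]surjective_pairing.
  rewrite (iM s (fun n => (f n).1)) ?(iN s (fun n => (f n).2)) // => k;
    by have := fMN k; rewrite inE => -[].
- move=> i j x r /set_mem [x1 x2] rj; apply/mem_set.
  by split; [apply: aM | apply: aN].
Qed.

Definition graded_dsum (M N : gradedModule) : gradedModule :=
  GradedModule (graded_dsum_subproof M N).

Definition zero_module (M : lmodType R) : Prop := forall x : M, x = 0.

Definition graded_indecomposable (M : gradedModule) : Prop :=
  ~ zero_module M /\
  forall N1 N2 : gradedModule, graded_isomorphic M (graded_dsum N1 N2) ->
    zero_module N1 \/ zero_module N2.

(* The supremum and infimum are taken in the integers extended by -oo and +oo,
   where every set has both. *)
Definition graded_length (M : gradedModule) : \bar int :=
  let degrees := EFin @` [set n | gcomp M n <> [set 0]] in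
  (supremum -oo degrees - infimum +oo degrees + 1)%E.

Definition gradable (M : lmodType R) : Prop :=
  exists (N : gradedModule) (f : {linear M -> N}), bijective f.

Definition bounded_graded_lengths : Prop :=
  exists b : nat, forall M : gradedModule,
    finitely_generated M -> graded_indecomposable M ->
    (graded_length M <= (b%:Z)%:E)%E.

End GradedModules.

Arguments gcomp [R Rg] _ _.

(* Main.v *)
Require Import Defs.
From HB Require Import structures.
From mathcomp Require Import all_boot all_order all_algebra.
From mathcomp Require Import all_classical constructive_ereal.
From mathcomp Require Import zify.

Set Implicit Arguments.
Unset Strict Implicit.
Unset Printing Implicit Defensive.

Import Order.TTheory GRing.Theory Num.Theory.
Local Open Scope classical_set_scope.
Local Open Scope ring_scope.

(** The bridge between right and left modules is the transpose of Auslander and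
    Bridger: if T is presented by a matrix A, so that T is the cokernel of A,
    the cokernel of the transposed matrix is a module on the other side. Since
    an artinian ring is noetherian (artinian_noetherian), all finitely generated
    modules have finite presentations. The transpose does not depend on the
    presentation up to free summands (transposed_stable_iso), transposing twice
    gives the module back, and a graded module has a homogeneous presentation,
    whose transpose is graded (graded_transpose).

    For gradability, let M be a left module and T a transpose of it. If T is
    isomorphic to a graded module T', then a graded transpose M' of T' satisfies
    M + R^k = M' + R^l up to isomorphism. The right-hand side is graded, and the
    point is to remove R^k from it (gradable_summand). This is done one graded
    indecomposable summand P at a time. The degree 0 endomorphisms of P form a
    local ring (graded_local), so an ungraded embedding of P as a summand has a
    homogeneous component which is split too, and this gives a graded complement
    of P; it is isomorphic to the ungraded one because finitely generated
    modules cancel from direct sums (cancellation).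

    For graded lengths, let M be a graded indecomposable left module and T a
    graded transpose of it. T is a direct sum of graded indecomposable modules,
    whose graded lengths are bounded by hypothesis; so are the graded lengths of
    their graded transposes, by the shape of homogeneous presentations. The same
    argument with local endomorphism rings shows that M is, up to a shift, a
    summand of one of these transposes or of R. That the ring lives in
    finitely many degrees also follows from the hypothesis, as it is a direct
    sum of graded indecomposable right modules.

    One implication is proved for two rings R and S with an anti-isomorphism
    between them, which is then used for R^c and R in both orders: the ring
    (R^c)^c is not convertible to R. *)

(** * Linear maps and submodules *)

Definition surjective (A B : Type) (f : A -> B) := forall y, exists x, f x = y.

Lemma inj_surj_bij (A B : Type) (f : A -> B) :
  injective f -> surjective f -> bijective f.
Proof.
move=> fI /choice[g gK]; exists g => // x; apply: fI; exact: gK.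
Qed.

Lemma bij_surj (A B : Type) (f : A -> B) : bijective f -> surjective f.
Proof. by case=> g _ gK y; exists (g y). Qed.

Definition mk_linear (R : pzRingType) (M N : lmodType R) (f : M -> N)
    (lf : linear f) : {linear M -> N} :=
  HB.pack f (GRing.isLinear.Build R M N *:%R f lf).

Section Linear.
Variables (R : pzRingType) (M N P : lmodType R).

Lemma linear_inj (f : {linear M -> N}) :
  (forall x, f x = 0 -> x = 0) -> injective f.
Proof.
move=> f0 x y fxy; apply/eqP; rewrite -subr_eq0; apply/eqP/f0.
by rewrite linearB fxy subrr.
Qed.

Lemma linear_bij_inv (f : {linear M -> N}) : bijective f ->
  exists g : {linear N -> M}, cancel f g /\ cancel g f.
Proof.
by move=> [g fK gK]; exists (mk_linear (can2_linear fK gK)).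
Qed.

Lemma linear_factor (p : {linear M -> N}) (f : {linear M -> P}) :
  surjective p -> (forall x, p x = 0 -> f x = 0) ->
  exists g : {linear N -> P}, forall x, g (p x) = f x.
Proof.
move=> /choice[s sK] pf.
have fE x y : p x = p y -> f x = f y.
  move=> pxy; apply/eqP; rewrite -subr_eq0 -linearB; apply/eqP/pf.
  by rewrite linearB pxy subrr.
have lg : linear (f \o s).
  by move=> a x y /=; rewrite -linearP; apply: fE; rewrite linearP !sK.
by exists (mk_linear lg) => x; apply: fE; rewrite sK.
Qed.

End Linear.

Definition iso (R : pzRingType) (M N : lmodType R) :=
  exists f : {linear M -> N}, bijective f.

Section Iso.
Variables (R : pzRingType) (M N P : lmodType R).

Lemma iso_sym : iso M N -> iso N M.
Proof.
by move=> [f /linear_bij_inv[g [fK gK]]]; exists g; exists f.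
Qed.

Lemma iso_trans : iso M N -> iso N P -> iso M P.
Proof.
by move=> [f fb] [g gb]; exists (g \o f); apply: bij_comp.
Qed.

End Iso.

Section Pairs.
Variables (R : pzRingType) (M N : lmodType R).

Fact fst_linear : linear (fst : M * N -> M). Proof. by []. Qed.
Fact snd_linear : linear (snd : M * N -> N). Proof. by []. Qed.
Fact injl_linear : linear (fun x => (x, 0) : M * N).
Proof.
by move=> a x y; apply: injective_projections; rewrite /= ?scaler0 ?addr0.
Qed.
Fact injr_linear : linear (fun y => (0, y) : M * N).
Proof.
by move=> a x y; apply: injective_projections; rewrite /= ?scaler0 ?addr0.
Qed.

Definition projl : {linear (M * N)%type -> M} := mk_linear fst_linear.
Definition projr : {linear (M * N)%type -> N} := mk_linear snd_linear.
Definition injl : {linear M -> (M * N)%type} := mk_linear injl_linear.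
Definition injr : {linear N -> (M * N)%type} := mk_linear injr_linear.

Lemma pair_inj (x : (M * N)%type) : x = injl (projl x) + injr (projr x).
Proof.
by case: x => x y; apply: injective_projections; rewrite /= ?addr0 ?add0r.
Qed.

End Pairs.
Arguments projl {R M N}.
Arguments projr {R M N}.
Arguments injl {R M N}.
Arguments injr {R M N}.

Section IsoPair.
Variables (R : pzRingType) (M N P : lmodType R).

Lemma iso_pairl : iso M N -> iso (M * P)%type (N * P)%type.
Proof.
move=> [f [g fK gK]].
have lf : linear (fun x : M * P => (f x.1, x.2) : (N * P)%type).
  by move=> a [x1 x2] [y1 y2] /=; rewrite linearP.
exists (mk_linear lf), (fun x : N * P => (g x.1, x.2)).
  by move=> [x y] /=; rewrite fK.
by move=> [x y] /=; rewrite gK.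
Qed.

Lemma iso_pairC : iso (M * N)%type (N * M)%type.
Proof.
have lf : linear (fun x : M * N => (x.2, x.1) : (N * M)%type) by [].
by exists (mk_linear lf), (fun x => (x.2, x.1)); case.
Qed.

Lemma iso_pairA : iso ((M * N) * P)%type (M * (N * P))%type.
Proof.
have lf : linear (fun x : (M * N) * P =>
    (x.1.1, (x.1.2, x.2)) : (M * (N * P))%type).
  by [].
exists (mk_linear lf), (fun x => ((x.1, x.2.1), x.2.2)); first by case=> -[].
by move=> [x []].
Qed.

Lemma iso_pair0 : (forall x : M, x = 0) -> iso (M * N)%type N.
Proof.
move=> M0.
have lf : linear (snd : (M * N)%type -> N) by [].
exists (mk_linear lf), (fun x => (0, x)) => //.
by move=> [x y] /=; rewrite (M0 x).
Qed.

End IsoPair.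

Section Submodules.
Variables (R : pzRingType) (M : lmodType R).
Implicit Types (X Y : set M) (s t : seq M).

Definition submod X := X 0 /\ forall a x y, X x -> X y -> X (a *: x + y).

Lemma submodP X : submod X <-> submod_closed [in X].
Proof.
split=> -[X0 XP]; split.
- by rewrite inE.
- by move=> a x y; rewrite !inE; apply: XP.
- by move: X0; rewrite inE.
- by move=> a x y Xx Xy; have := XP a x y; rewrite !inE; apply.
Qed.

Lemma submod0 X : submod X -> X 0. Proof. by case. Qed.

Lemma submodD X x y : submod X -> X x -> X y -> X (x + y).
Proof. by move=> [_ XP] Xx Xy; rewrite -[x]scale1r; apply: XP. Qed.

Lemma submodZ X a x : submod X -> X x -> X (a *: x).
Proof. by move=> [X0 XP] Xx; rewrite -[_ *: _]addr0; apply: XP. Qed.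

Lemma submodB X x y : submod X -> X x -> X y -> X (x - y).
Proof.
by move=> sX Xx Xy; apply: submodD => //; rewrite -scaleN1r; apply: submodZ.
Qed.

Lemma submod_sum X (I : Type) (r : seq I) (F : I -> M) :
  submod X -> (forall i, X (F i)) -> X (\sum_(i <- r) F i).
Proof.
move=> sX XF; elim/big_ind: _ => //; first exact: submod0.
by move=> x y; apply: submodD.
Qed.

Lemma submodT : submod setT. Proof. by []. Qed.

Lemma submod_zero : submod [set 0].
Proof. by split=> // a x y -> ->; rewrite /= scaler0 addr0. Qed.

Lemma submodI X Y : submod X -> submod Y -> submod (X `&` Y).
Proof.
by move=> [X0 XP] [Y0 YP]; split=> // a x y [? ?] [? ?]; split; auto.
Qed.

Definition sumset X Y : set M := [set z | exists x y, [/\ X x, Y y & z = x + y]].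

Lemma submod_sumset X Y : submod X -> submod Y -> submod (sumset X Y).
Proof.
move=> sX sY; split.
  by exists 0, 0; rewrite addr0; split=> //; apply: submod0.
move=> a _ _ [x [y [Xx Yy ->]]] [x' [y' [Xx' Yy' ->]]].
exists (a *: x + x'), (a *: y + y'); split; [exact: sX.2|exact: sY.2|].
by rewrite scalerDr addrACA.
Qed.

Fixpoint span s : set M :=
  if s is g :: s' then [set x | exists c : R, span s' (x - c *: g)]
  else [set 0].

Lemma submod_span s : submod (span s).
Proof.
elim: s => [|g s IHs] /=; first exact: submod_zero.
split; first by exists 0; rewrite scale0r subr0; apply: submod0.
move=> a x y [c xc] [d yd]; exists (a * c + d).
rewrite scalerDl opprD addrACA -scalerA -scalerBr.
exact: IHs.2.
Qed.

Lemma span_subset s X : submod X -> (forall x, x \in s -> X x) -> span s `<=` X.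
Proof.
move=> sX; elim: s => [|g s IHs] sub x /=.
  by move=> ->; apply: submod0.
move=> [c xc]; rewrite -[x](subrK (c *: g)); apply: submodD => //.
  by apply: IHs xc => y ys; apply: sub; rewrite inE ys orbT.
by apply: submodZ => //; apply: sub; rewrite mem_head.
Qed.

Lemma mem_span s x : x \in s -> span s x.
Proof.
elim: s => [//|g s IHs]; rewrite inE => /predU1P[->|xs] /=.
  by exists 1; rewrite scale1r subrr; apply: submod0; apply: submod_span.
by exists 0; rewrite scale0r subr0; apply: IHs.
Qed.

Lemma span_mono s t : {subset s <= t} -> span s `<=` span t.
Proof.
move=> st; apply: span_subset; first exact: submod_span.
by move=> x /st; apply: mem_span.
Qed.

Lemma spanP s x : span s x <->
  exists c : 'I_(size s) -> R, x = \sum_i c i *: s`_i.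
Proof.
split.
  elim: s x => [|g s IHs] x /=.
    by move=> ->; exists (fun=> 0); rewrite big_ord0.
  move=> [c /IHs[d xE]].
  exists (fun i => oapp d c (unlift ord0 i)).
  rewrite big_ord_recl /= unlift_none /=; apply/eqP; rewrite addrC -subr_eq.
  apply/eqP; rewrite xE; apply: eq_bigr => i _; congr (_ *: _).
  by rewrite liftK.
move=> [c ->]; elim/big_ind: _ => //.
- by apply: submod0; apply: submod_span.
- by move=> y z; apply: submodD; apply: submod_span.
- move=> i _; apply: submodZ; first exact: submod_span.
  by apply: mem_span; apply: mem_nth.
Qed.

Lemma finitely_generatedP :
  finitely_generated M <-> exists s : seq M, forall x, span s x.
Proof.
split=> [[n [g gP]]|[s sP]].
  exists (codom g) => x; have [c ->] := gP x.
  elim/big_ind: _ => //; first by apply: submod0; apply: submod_span.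
    by move=> y z; apply: submodD; apply: submod_span.
  move=> i _; apply: submodZ; first exact: submod_span.
  by apply: mem_span; apply: codom_f.
by exists (size s), (fun i => s`_i) => x; apply/spanP.
Qed.

Definition fg X := exists s, forall x, X x <-> span s x.

Definition noetherian := forall X, submod X -> fg X.

Definition gen (A : set M) : set M :=
  [set x | forall X, submod X -> A `<=` X -> X x].

Lemma submod_gen A : submod (gen A).
Proof.
split=> [X [] //|a x y gx gy X sX AX].
by apply: sX.2; [apply: gx|apply: gy].
Qed.

Lemma sub_gen A : A `<=` gen A.
Proof. by move=> x Ax X _; apply. Qed.

Lemma gen_subset A X : submod X -> A `<=` X -> gen A `<=` X.
Proof. by move=> sX AX x; apply. Qed.

End Submodules.

Section Preimages.
Variables (R : pzRingType) (M N : lmodType R) (f : {linear M -> N}).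

Lemma submod_preimage (Y : set N) : submod Y -> submod (f @^-1` Y).
Proof.
move=> sY; split=> [|a x y]; rewrite /preimage /= ?linear0; first exact: submod0.
by rewrite linearP; apply: sY.2.
Qed.

Lemma submod_image (X : set M) : submod X -> submod (f @` X).
Proof.
move=> sX; split; first by exists 0; rewrite ?linear0 //; apply: submod0.
move=> a _ _ [x Xx <-] [y Xy <-]; exists (a *: x + y); rewrite ?linearP //.
exact: sX.2.
Qed.

Lemma submod_ker : submod [set x | f x = 0].
Proof. exact: (submod_preimage (submod_zero N)). Qed.

Lemma submod_range : submod (range f).
Proof. exact: (submod_image (submodT M)). Qed.

Lemma fg_image : surjective f -> finitely_generated M -> finitely_generated N.
Proof.
move=> fS /finitely_generatedP[s sP]; apply/finitely_generatedP.
exists (map f s) => y; have [x <-] := fS y.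
apply: (@span_subset _ _ s (f @^-1` span (map f s))) (sP x).
  by apply/submod_preimage/submod_span.
by move=> z zs; apply: mem_span; apply: map_f.
Qed.

End Preimages.

(** * Chain conditions *)

(** Dependent choice turns the absence of infinite descending chains, which is
    how chain conditions are given, into the existence of minimal elements. *)
Lemma no_chain_minimal (T : Type) (lt : T -> T -> Prop) (P : T -> Prop) (x0 : T) :
  P x0 ->
  (forall u : nat -> T, (forall n, P (u n)) -> (forall n, lt (u n.+1) (u n)) ->
    False) ->
  exists x, P x /\ forall y, P y -> ~ lt y x.
Proof.
move=> Px0 nochain; apply: contrapT => nomin.
have step (x : {x | P x}) : exists y : {x | P x}, lt (sval y) (sval x).
  apply: contrapT => nolt; apply: nomin; exists (sval x).
  split=> [|y Py ltyx]; first by case: x {nolt}.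
  by apply: nolt; exists (exist _ y Py).
have [next nextP] := choice step.
pose u n := iter n next (exist _ x0 Px0).
apply: (nochain (fun n => sval (u n))) => n; first by case: (u n).
exact: nextP.
Qed.

Section ChainConditions.
Variables (R : pzRingType) (M : lmodType R).
Implicit Types X Y : set M.

Lemma artinian_minimal (P : set M -> Prop) X0 : artinian_module M ->
  (forall X, P X -> submod X) -> P X0 ->
  exists X, P X /\ forall Y, P Y -> Y `<=` X -> Y = X.
Proof.
move=> art subP PX0.
have [] := @no_chain_minimal _ (fun Y X => Y `<=` X /\ Y <> X) P X0 PX0.
  move=> u Pu ltu; have [|n|n stab] := art u.
  - by move=> n; apply: (submodP (u n)).1; apply: subP.
  - exact: (ltu n).1.
  - by apply: (ltu n).2; rewrite stab.
move=> X [PX minX]; exists X; split=> // Y PY YX.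
by apply: contrapT => YneX; apply: minX PY _.
Qed.

Lemma noetherian_maximal (P : set M -> Prop) X0 : noetherian M ->
  (forall X, P X -> submod X) -> P X0 ->
  exists X, P X /\ forall Y, P Y -> X `<=` Y -> Y = X.
Proof.
move=> noe subP PX0.
have [] := @no_chain_minimal _ (fun Y X => X `<=` Y /\ Y <> X) P X0 PX0.
  move=> u Pu ltu.
  have mono m n : (m <= n)%N -> u m `<=` u n.
    move=> /subnK <-; elim: (n - m)%N => [//|k IHk].
    by apply: subset_trans IHk _; apply: (ltu _).1.
  pose U := [set x | exists n, u n x].
  have sU : submod U.
    split=> [|a x y [m ux] [n uy]]; first by exists 0%N; apply: submod0; apply: subP.
    exists (maxn m n); apply: (subP _ (Pu _)).2.
      by apply: mono ux; rewrite leq_maxl.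
    by apply: mono uy; rewrite leq_maxr.
  have [s sP] := noe U sU.
  have [n sn] : exists n, forall x, x \in s -> u n x.
    have : forall x, x \in s -> U x by move=> x xs; apply/sP/mem_span.
    elim: s {sP} => [_|g s IHs sU']; first by exists 0%N.
    have [|n nP] := IHs; first by move=> x xs; apply: sU'; rewrite inE xs orbT.
    have [|m mP] := sU' g; first exact: mem_head.
    exists (maxn m n) => x; rewrite inE => /predU1P[->|/nP].
      by apply: mono mP; rewrite leq_maxl.
    by apply: mono; rewrite leq_maxr.
  apply: (ltu n).2; apply/seteqP; split; last exact: (ltu n).1.
  move=> x ux; apply: (span_subset (subP _ (Pu n)) sn); apply/sP.
  by exists n.+1.
move=> X [PX maxX]; exists X; split=> // Y PY XY.
by apply: contrapT => YneX; apply: maxX PY _.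
Qed.

(** By induction on the generators: a submodule of the module generated by g
    and s is determined, within a chain, by its intersection with the span of s
    and by the left ideal of the coefficients of g in its elements. *)
Lemma artinian_fg : left_artinian R -> finitely_generated M -> artinian_module M.
Proof.
move=> artR /finitely_generatedP[s sP] I cI decI.
have sI n : submod (I n) by apply: (submodP (I n)).2; apply: cI.
have mono m n : (m <= n)%N -> I n `<=` I m.
  move=> /subnK <-; elim: (n - m)%N => [//|k IHk].
  by apply: subset_trans IHk; apply: decI.
have {sP} : forall n, I n `<=` span s by move=> n x _.
elim: s I {cI} sI decI mono => [|g s IHs] I sI decI mono Is.
  exists 0%N => m _; apply/seteqP.
  by split=> x /Is/= ->; apply: submod0.
pose J n := I n `&` span s.
have [||||n1 stabJ] := IHs J.
- by move=> n; apply: submodI => //; apply: submod_span.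
- by move=> n x [Ix sx]; split=> //; apply: decI.
- by move=> m n mn x [Ix sx]; split=> //; apply: mono Ix.
- by move=> n x [].
pose L n : set R^o := [set c | exists2 y, span s y & I n (c *: g + y)].
have [|n x [y sy Iy]|n2 stabL] := artR L.
- move=> n; apply: (submodP (L n)).1; split.
    exists 0; first exact: submod0 (submod_span s).
  by rewrite scale0r addr0; apply: submod0 (sI n).
  move=> a x y [x' sx' Ix'] [y' sy' Iy'].
  exists (a *: x' + y'); first exact: (submod_span s).2.
  by rewrite scalerDl -scalerA addrACA -scalerDr; apply: (sI n).2.
- by exists y => //; apply: decI.
exists (maxn n1 n2) => m lem; have [le1 le2] : (n1 <= m /\ n2 <= m)%N.
  by move: lem; rewrite geq_max => /andP.
apply/seteqP; split=> [|x Ix]; first exact: mono.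
have [c sxc] := Is _ _ Ix.
have [y sy Iy] : L m c.
  rewrite stabL // -(stabL (maxn n1 n2)) ?leq_maxr //.
  by exists (x - c *: g) => //; rewrite addrC subrK.
have : J m (x - (c *: g + y)).
  rewrite stabJ // -(stabJ (maxn n1 n2)) ?leq_maxl //; split.
    by apply: submodB => //; apply: mono Iy.
  by rewrite opprD addrA; apply: submodB => //; apply: submod_span.
by move=> [Im _]; rewrite -(subrK (c *: g + y) x); apply: submodD.
Qed.

End ChainConditions.

(** * Artinian modules over an artinian ring are noetherian *)

Section Hopkins.
Variables (R : pzRingType) (M : lmodType R).
Hypothesis artR : left_artinian R.

Definition ideal_mul (K : set R^o) (T : set M) : set M :=
  gen [set x | exists k t, [/\ K k, T t & x = (k : R) *: t]].

Lemma ideal_mul_subset (K : set R^o) (T X : set M) : submod X ->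
  (forall k t, K k -> T t -> X ((k : R) *: t)) -> ideal_mul K T `<=` X.
Proof.
by move=> sX KTX; apply: gen_subset => // _ [k [t [Kk Tt ->]]]; apply: KTX.
Qed.

Lemma mem_ideal_mul (K : set R^o) (T : set M) k t :
  K k -> T t -> ideal_mul K T ((k : R) *: t).
Proof. by move=> Kk Tt; apply: sub_gen; exists k, t. Qed.

(** K is a minimal left ideal with KT = T; then KK = K. A minimal left ideal L
    among those not killed by K has the form Kx with x in L, and all its proper
    submodules are killed by K, so that L has a largest proper submodule. The
    kernel A of r |-> rx modulo that submodule is a proper left ideal of K such
    that K / A is simple; AT differs from T by minimality of K. *)
Lemma exists_simple_layer (T : set M) :
  submod T -> ~ T `<=` [set 0] ->
  exists (K A : set R^o), [/\ submod K, T `<=` ideal_mul K T,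
    ~ T `<=` ideal_mul A T &
    forall r q, K r -> ~ A r -> K q -> exists s, A (q - s * r)].
Proof.
move=> sT T0.
have [||K [[sK KT] minK]] := @artinian_minimal _ _
    (fun K : set R^o => submod K /\ T `<=` ideal_mul K T) setT artR.
- by move=> X [].
- split; first exact: submodT.
  by move=> t Tt; rewrite -[t]scale1r; apply: mem_ideal_mul.
(* K K T = K T = T, so K K = K by minimality *)
pose KK : set R^o :=
  @gen R R^o [set x | exists k k', [/\ K k, K k' & x = (k : R) * k']].
have KK_K : KK = K.
  apply: minK; last first.
    by apply: gen_subset => // _ [k [k' [_ Kk' ->]]]; apply: submodZ.
  split; first exact: submod_gen.
  pose X : set M :=
    [set x | forall k r, K k -> ideal_mul KK T (((k : R) * r) *: x)].
  have TX : T `<=` X.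
    apply: subset_trans KT _; apply: ideal_mul_subset.
      split=> [k r Kk|a x y Xx Xy k r Kk].
        by rewrite scaler0; exact: submod0 (submod_gen _).
      rewrite scalerDr scalerA -mulrA.
      by apply: (submodD (submod_gen _)); [exact: Xx|exact: Xy].
    move=> k' t Kk' Tt k r Kk; rewrite scalerA -mulrA; apply: mem_ideal_mul => //.
    apply: sub_gen; exists k, (r * k'); split=> //; exact: (submodZ r sK Kk').
  apply: subset_trans KT _; apply: ideal_mul_subset; first exact: submod_gen.
  by move=> k t Kk Tt; have := TX t Tt k 1 Kk; rewrite mulr1.
pose nonzero (L : set R^o) := exists k l, [/\ K k, L l & (k : R) * l <> 0].
have [||L [[sL [a0 [x [Ka0 Lx a0x]]]] minL]] := @artinian_minimal _ _
    (fun L : set R^o => submod L /\ nonzero L) K artR.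
- by move=> X [].
- split=> //; apply: contrapT => Kzero; apply: T0.
  apply: subset_trans KT _; apply: ideal_mul_subset; first exact: submod_zero.
  move=> k t Kk Tt; rewrite /=.
  suff -> : k = 0 by rewrite scale0r.
  move: Kk; rewrite -{1}KK_K => /(_ [set 0]); apply; first exact: submod_zero.
  move=> _ [k1 [k2 [Kk1 Kk2 ->]]] /=; apply: contrapT => kk; apply: Kzero.
  by exists k1, k2.
have sRx (b : R) (I : set R^o) : submod I ->
    submod [set y : R^o | exists2 c : R, I c & y = c * b].
  move=> sI; split; first by exists 0; [exact: submod0 sI|rewrite mul0r].
  move=> a _ _ [c Ic ->] [d Id ->]; exists (a * c + d); first exact: (sI.2 a).
  by rewrite mulrDl -mulrA.
have Kx : [set y : R^o | exists2 c : R, K c & y = c * x] = L.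
  apply: minL; last by move=> _ [c Kc ->]; apply: (submodZ c sL Lx).
  split; first exact: sRx.
  apply: contrapT => Kxzero; apply: a0x.
  have : KK a0 by rewrite KK_K.
  move/(_ [set r : R^o | (r : R) * x = 0]); apply.
    split; first by rewrite /= mul0r.
    by move=> a r1 r2 /= r1x r2x; rewrite mulrDl -mulrA r1x r2x mulr0 addr0.
  move=> _ [k1 [k2 [Kk1 Kk2 ->]]] /=; apply: contrapT => kk; apply: Kxzero.
  exists k1, (k2 * x); split=> //; first by exists k2.
  by rewrite mulrA.
have [a Ka xax] : exists2 a : R, K a & x = a * x.
  by move: (Lx); rewrite -{1}Kx => -[c Kc xc]; exists c.
pose A : set R^o := [set r | K r /\ forall k s, K k -> (k : R) * (s * (r * x)) = 0].
have sA : submod A.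
  split; first by split; [exact: submod0 sK|move=> k s _; rewrite mul0r !mulr0].
  move=> c r1 r2 [Kr1 r1P] [Kr2 r2P]; split; first exact: sK.2.
  move=> k s Kk; rewrite mulrDl !mulrDr r2P // addr0 -!mulrA.
  by rewrite [s * (c * _)]mulrA r1P.
exists K, A; split=> //.
  move=> AT; have AK : A = K by apply: minK => // r [].
  move: (Ka); rewrite -AK => -[_ /(_ a0 1 Ka0)].
  by rewrite -xax mul1r.
move=> r q Kr Ar Kq.
have Rrx : [set y : R^o | exists2 c : R, setT c & y = c * (r * x)] = L.
  apply: minL; last first.
    by move=> _ [c _ ->]; rewrite mulrA; apply: (submodZ (c * r) sL Lx).
  split; first exact: sRx (submodT _).
  apply: contrapT => rxzero; apply: Ar; split=> // k s Kk.
  apply: contrapT => ks; apply: rxzero; exists k, (s * (r * x)); split=> //.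
  by exists s.
have [s0 _ xE] : exists2 c : R, setT c & x = c * (r * x).
  by move: (Lx); rewrite -{1}Rrx.
exists (q * s0); split; first by apply: (submodB sK Kq); apply: submodZ.
move=> k s Kk; suff -> : (q - q * s0 * r) * x = 0 by rewrite !mulr0.
by rewrite mulrBl {1}xE -!mulrA subrr.
Qed.

(** Hopkins' theorem, without the Jacobson radical. If M is not noetherian, it
    has a minimal submodule T that is not finitely generated. With K and A from
    the previous lemma and U = AT, each Kt is zero or simple modulo U, so T / U
    is a sum of simple modules and T has a maximal submodule W. By minimality W
    is finitely generated, hence so is T. *)
Lemma artinian_noetherian : artinian_module M -> noetherian M.
Proof.
move=> artM X0 sX0; apply: contrapT => nfgX0.
have [||T [[sT nfgT] minT]] := @artinian_minimal _ _
    (fun X : set M => submod X /\ ~ fg X) X0 artM; [by move=> X []|by []|].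
have T0 : ~ T `<=` [set 0].
  move=> T0; apply: nfgT; exists [::] => x; split; first exact: T0.
  by move=> ->; apply: submod0.
have [K [A [sK KT AT layer]]] := exists_simple_layer sT T0.
pose U := ideal_mul A T.
have sU : submod U by apply: submod_gen.
have UT : U `<=` T.
  by apply: ideal_mul_subset => // k t _ Tt; apply: submodZ.
have simple t k q : T t -> K k -> K q -> ~ U ((k : R) *: t) ->
    exists s : R, U ((q : R) *: t - s *: ((k : R) *: t)).
  move=> Tt Kk Kq nU; have [Ak|s As] := layer _ _ Kk _ Kq.
    by apply: nU; apply: mem_ideal_mul.
  by exists s; rewrite scalerA -scalerBl; apply: mem_ideal_mul.
have [v Tv Uv] : exists2 v, T v & ~ U v.
  apply: contrapT => nov; apply: AT => t Tt; apply: contrapT => Ut.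
  by apply: nov; exists t.
have [W [[[sW [UW WT]] Wv] maxW]] : exists W,
    ((submod W /\ (U `<=` W /\ W `<=` T)) /\ ~ W v) /\
    forall Y, submod Y -> Y `<=` T -> W `<=` Y -> ~ Y v -> Y `<=` W.
  have [] := @Zorn_bigcup M (fun W => W = set0 \/
      (submod W /\ (U `<=` W /\ W `<=` T)) /\ ~ W v).
    move=> F FP totF.
    have [[W FW W0]|noW] := pselect (exists2 W, F W & W <> set0); last first.
      left; apply/seteqP; split=> // x [W FW Wx]; apply: noW; exists W => //.
      by move=> W0; rewrite W0 in Wx.
    have FE Y y : F Y -> Y y -> (submod Y /\ (U `<=` Y /\ Y `<=` T)) /\ ~ Y v.
      by move=> /FP[->|].
    have [w Ww] : exists w, W w by apply/set0P/eqP.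
    have [[sW [UW WT]] Wv] := FE _ _ FW Ww.
    right; split; last by move=> [Y FY Yv]; have [_] := FE _ _ FY Yv.
    split; [split|split].
    - by exists W => //; apply: submod0.
    - move=> a x y [X FX Xx] [Y FY Yy].
      have [XY|YX] := totF _ _ FX FY.
        have [[sY _] _] := FE _ _ FY Yy.
        by exists Y => //; apply: sY.2 => //; apply: XY.
      have [[sX _] _] := FE _ _ FX Xx.
      by exists X => //; apply: sX.2 => //; apply: YX.
    - by move=> x Ux; exists W => //; apply: UW.
    - by move=> x [Y FY Yx]; have [[_ [_ YT]] _] := FE _ _ FY Yx; apply: YT.
  move=> W [[W0|WP] maxW].
    have := maxW U; case.
      by rewrite W0; split=> [x []|/(_ 0 (submod0 sU))].
    by right; split=> //; split=> //; split.
  exists W; split=> // Y sY YT WY Yv; apply: contrapT => nYW.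
  apply: (maxW Y); first by split.
  right; split=> //; split=> //; split=> //; apply: subset_trans WY.
  by case: WP => -[_ []].
(* W was chosen maximal for avoiding v; it turns out to be a maximal submodule *)
pose Wv' := sumset W [set x | exists c, x = c *: v].
have sv : submod [set x | exists c, x = c *: v].
  split; first by exists 0; rewrite scale0r.
  by move=> a _ _ [c ->] [d ->]; exists (a * c + d); rewrite scalerDl scalerA.
have KTW : T `<=` Wv'.
  apply: subset_trans KT _; apply: ideal_mul_subset; first exact: submod_sumset.
  move=> k t Kk Tt.
  have [Wkt|nWkt] := pselect (W ((k : R) *: t)).
    by exists ((k : R) *: t), 0; rewrite addr0; split=> //; exists 0; rewrite scale0r.
  pose Z := sumset W [set x | exists c, x = c *: ((k : R) *: t)].
  have skt : submod [set x | exists c, x = c *: ((k : R) *: t)].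
    split; first by exists 0; rewrite scale0r.
    by move=> a _ _ [c ->] [d ->]; exists (a * c + d); rewrite scalerDl scalerA.
  have Zkt : Z ((k : R) *: t).
    exists 0, ((k : R) *: t); split; first exact: submod0.
      by exists 1; rewrite scale1r.
    by rewrite add0r.
  have [w [_ [Ww [s ->] vE]]] : Z v.
    apply: contrapT => nZv; apply: nWkt.
    apply: (maxW Z) => //; first exact: submod_sumset.
      move=> _ [w [_ [Ww [c ->] ->]]]; apply: submodD => //; first exact: WT.
      by apply: submodZ => //; apply: submodZ.
    by move=> w Ww; exists w, 0; rewrite addr0; split=> //; exists 0; rewrite scale0r.
  have Ksk : K (s * k) by exact: (submodZ s sK Kk).
  have [Uskt|nUskt] := pselect (U ((s * k) *: t)).
    by case: Wv; rewrite vE scalerA; apply: submodD => //; apply: UW.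
  have [s' Us'] := simple t (s * k) k Tt Ksk Kk nUskt.
  exists ((k : R) *: t - s' *: v), (s' *: v).
  split; [|by exists s'|by rewrite subrK].
  have -> : (k : R) *: t - s' *: v =
      ((k : R) *: t - s' *: ((s * k) *: t)) - s' *: w.
    by rewrite -[(s * k) *: t]scalerA vE scalerDr opprD addrA addrAC.
  by apply: submodB => //; [apply: UW|apply: submodZ].
have WneT : W <> T by move=> WT'; apply: Wv; rewrite WT'.
have [s sP] : fg W.
  by apply: contrapT => nfgW; apply: WneT; apply: minT.
apply: nfgT; exists (v :: s) => x; split.
  by move=> /KTW[w [_ [Ww [c ->] ->]]]; exists c; rewrite addrK; apply/sP.
move=> [c /sP/WT Tx]; rewrite -[x](subrK (c *: v)); apply: submodD => //.
exact: submodZ.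
Qed.

End Hopkins.

Lemma noetherian_fg (R : pzRingType) (M : lmodType R) :
  left_artinian R -> finitely_generated M -> noetherian M.
Proof. by move=> artR fgM; apply: artinian_noetherian => //; apply: artinian_fg. Qed.

(** * Quotient modules *)

Section Quotient.
Variables (R : pzRingType) (M : lmodType R) (X : set M).
Hypothesis sX : submod X.

Fact mem_submod_closed : zmod_closed [in X].
Proof. by split=> [|x y]; rewrite !inE; [exact: submod0|exact: submodB]. Qed.

Definition submod_zmod_closed : zmodClosed M :=
  HB.pack (fun x : M => x \in X) (GRing.isZmodClosed.Build M _ mem_submod_closed).

Definition quot_module : Type := Quotient.quot submod_zmod_closed.
HB.instance Definition _ := GRing.Zmodule.on quot_module.

Definition quot_pi (x : M) : quot_module :=
  (\pi_(Quotient.quot submod_zmod_closed) x)%qT.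
Definition quot_repr (y : quot_module) : M :=
  @repr M (Quotient.quot submod_zmod_closed) y.
Definition quot_scale (a : R) (y : quot_module) : quot_module :=
  quot_pi (a *: quot_repr y).

Lemma quot_reprK y : quot_pi (quot_repr y) = y.
Proof. exact: reprK. Qed.

Lemma quot_piE x y : quot_pi x = quot_pi y <-> X (x - y).
Proof.
have /(congr1 is_true) := Quotient.idealrBE submod_zmod_closed x y.
rewrite /= => E; split=> [H|H].
  have : x - y \in submod_zmod_closed by rewrite E; apply/eqP.
  by rewrite unfold_in /= inE.
have : x - y \in submod_zmod_closed by rewrite unfold_in /= inE.
by rewrite E => /eqP.
Qed.

Lemma quot_piD x y : quot_pi (x + y) = quot_pi x + quot_pi y.
Proof. exact: (@Quotient.pi_add _ submod_zmod_closed). Qed.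

Lemma quot_pi_scale a x : quot_pi (a *: x) = quot_scale a (quot_pi x).
Proof.
apply/quot_piE; rewrite -scalerBr; apply: submodZ => //.
by apply/quot_piE; rewrite quot_reprK.
Qed.

Fact quot_scaleA a b y :
  quot_scale a (quot_scale b y) = quot_scale (a * b) y.
Proof. by rewrite -[y]quot_reprK -!quot_pi_scale scalerA. Qed.

Fact quot_scale1 : left_id 1 quot_scale.
Proof. by move=> y; rewrite -[y]quot_reprK -!quot_pi_scale scale1r. Qed.

Fact quot_scaleDr : right_distributive quot_scale +%R.
Proof.
move=> a x y; rewrite -[x]quot_reprK -[y]quot_reprK.
by rewrite -quot_piD -!quot_pi_scale -quot_piD scalerDr.
Qed.

Fact quot_scaleDl y : {morph quot_scale^~ y : a b / a + b}.
Proof.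
move=> a b; rewrite -[y]quot_reprK -!quot_pi_scale -quot_piD scalerDl.
by [].
Qed.

HB.instance Definition _ := GRing.Zmodule_isLmodule.Build R quot_module
  quot_scaleA quot_scale1 quot_scaleDr quot_scaleDl.

Fact quot_pi_linear : linear quot_pi.
Proof. by move=> a x y; rewrite quot_piD quot_pi_scale. Qed.

End Quotient.

Lemma quotient_ex (R : pzRingType) (M : lmodType R) (X : set M) : submod X ->
  exists (Q : lmodType R) (p : {linear M -> Q}),
    surjective p /\ forall x, p x = 0 <-> X x.
Proof.
move=> sX; exists (quot_module sX : lmodType R), (mk_linear (quot_pi_linear sX)).
split=> [y|x]; first by exists (quot_repr y); apply: quot_reprK.
rewrite /= -[X in _ = X](linear0 (mk_linear (quot_pi_linear sX))) /=.
by have := quot_piE sX x 0; rewrite subr0.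
Qed.

(** * Gradings through their projections *)

Lemma big_pad (V : zmodType) (s t : seq int) (f : int -> V) :
  uniq s -> uniq t -> {subset s <= t} -> (forall n, n \notin s -> f n = 0) ->
  \sum_(n <- t) f n = \sum_(n <- s) f n.
Proof.
move=> us ut st f0; rewrite (bigID (mem s)) /= [X in _ + X]big1 ?addr0.
  rewrite -big_filter; apply: perm_big; apply: uniq_perm => //.
    exact: filter_uniq.
  by move=> n; rewrite mem_filter; case: (boolP (n \in s)) => // /st.
by move=> n ns; apply: f0.
Qed.

Section Grading.
Variables (V : zmodType) (Vg : int -> set V).

(** A grading is the same as a family of orthogonal projections onto the
    components, finitely many of which are nonzero at each element. *)
Definition is_projection (p : int -> V -> V) :=
  [/\ forall n x y, p n (x - y) = p n x - p n y,
      forall n x, Vg n (p n x),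
      forall n x, Vg n x -> forall m, p m x = if m == n then x else 0
    & forall x, exists s, [/\ uniq s, forall n, n \notin s -> p n x = 0
                             & x = \sum_(n <- s) p n x]].

Lemma zmod_closed_set (X : set V) :
  zmod_closed [in X] <-> X 0 /\ forall x y, X x -> X y -> X (x - y).
Proof.
split=> -[X0 XB]; split.
- by move: X0; rewrite inE.
- by move=> x y Xx Xy; have := XB x y; rewrite !inE; apply.
- by rewrite inE.
- by move=> x y; rewrite !inE; apply: XB.
Qed.

Lemma projection_grading p :
  (forall n, Vg n 0 /\ forall x y, Vg n x -> Vg n y -> Vg n (x - y)) ->
  is_projection p -> is_grading Vg.
Proof.
move=> VgP [pB pV pid psupp]; split.
- by move=> n; apply: (zmod_closed_set (Vg n)).2.
- move=> x; have [s [us _ xE]] := psupp x; exists s, (p^~ x); split=> // n.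
  by rewrite inE.
move=> s f us fV sum0 n ns.
have p0 m : p m 0 = 0 by have := pB m 0 0; rewrite !subrr.
have pD m x y : p m (x + y) = p m x + p m y.
  by rewrite -[y in LHS]opprK -[- y]sub0r pB pB p0 sub0r opprK.
have : p n (\sum_(m <- s) f m) = f n.
  rewrite (big_morph (p n) (pD n) (p0 n)) (bigD1_seq n) //=.
  have fVn m : Vg m (f m) by have := fV m; rewrite inE.
  rewrite (pid _ _ (fVn n)) eqxx big1 ?addr0 // => m mn.
  by rewrite (pid _ _ (fVn m)) eq_sym (negPf mn).
by rewrite sum0 p0.
Qed.

Lemma grading_projection : is_grading Vg -> exists p, is_projection p.
Proof.
move=> [cV0 decV indV]; have cV n := (zmod_closed_set (Vg n)).1 (cV0 n).
have [s sP] := choice decV; have [f fP] := choice sP.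
pose p n x := if n \in s x then f x n else 0.
have fV x n : Vg n (f x n) by have [_ /(_ n)] := fP x; rewrite inE.
(* uniqueness of the decomposition: any decomposition g of x computes p *)
have pE x t g : uniq t -> (forall n, Vg n (g n)) ->
    (forall n, n \notin t -> g n = 0) ->
    x = \sum_(n <- t) g n -> forall n, p n x = g n.
  move=> ut gV g0 xE n; have [us _ xE'] := fP x.
  pose h m := p m x - g m.
  have hV m : h m \in Vg m.
    rewrite inE; apply: (cV m).2 => //; rewrite /p; case: ifP => // _.
    exact: (cV m).1.
  have h0 m : m \notin undup (s x ++ t) -> h m = 0.
    rewrite mem_undup mem_cat negb_or /h /p => /andP[/negPf-> /g0->].
    by rewrite subr0.
  have sum0 : \sum_(m <- undup (s x ++ t)) h m = 0.
    rewrite sumrB [X in _ - X](big_pad (s := t)) ?undup_uniq //; last first.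
      by move=> m mt; rewrite mem_undup mem_cat mt orbT.
    rewrite [X in X - _](big_pad (s := s x)) ?undup_uniq //.
    - rewrite -xE (eq_big_seq (f x)) -?xE' ?subrr // => m ms.
      by rewrite /p ms.
    - by move=> m ms; rewrite mem_undup mem_cat ms.
    - by move=> m /negPf ms; rewrite /p ms.
  apply/eqP; rewrite -subr_eq0; apply/eqP; rewrite -/(h n).
  have [/(indV _ _ (undup_uniq _) hV sum0)//|/h0//] := boolP (n \in undup (s x ++ t)).
have pV n x : Vg n (p n x) by rewrite /p; case: ifP => // _; exact: (cV n).1.
have psum x t : uniq t -> {subset s x <= t} -> x = \sum_(n <- t) p n x.
  move=> ut st; have [us _ {1}->] := fP x.
  rewrite (big_pad us ut st) => [|n /negPf ns]; last by rewrite /p ns.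
  by apply: eq_big_seq => n ns; rewrite /p ns.
exists p; split=> //.
- move=> n x y; apply: (pE _ (undup (s x ++ s y)) (fun n => p n x - p n y)).
  + exact: undup_uniq.
  + by move=> m; apply: (cV m).2.
  + move=> m; rewrite mem_undup mem_cat negb_or /p => /andP[/negPf-> /negPf->].
    by rewrite subrr.
  + rewrite sumrB -!psum ?undup_uniq // => m ms;
      by rewrite mem_undup mem_cat ms ?orbT.
- move=> n x Vx m.
  apply: (pE x [:: n] (fun m => if m == n then x else 0)) => //.
  + by move=> k; case: eqP => [->//|_]; exact: (cV k).1.
  + by move=> k; rewrite inE => /negPf->.
  + by rewrite big_seq1 eqxx.
move=> x; exists (s x); split; [by have [] := fP x| |].
  by move=> n /negPf ns; rewrite /p ns.
by apply: psum => //; have [] := fP x.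
Qed.

Definition gr_proj (gV : is_grading Vg) := sval (cid (grading_projection gV)).

Variable gV : is_grading Vg.
Local Notation p := (gr_proj gV).

Lemma gr_projP : is_projection p.
Proof. exact: svalP (cid (grading_projection gV)). Qed.

Lemma gr_projB n : {morph p n : x y / x - y}.
Proof. by move=> x y; case: gr_projP => pB _ _ _; apply: pB. Qed.

Lemma gr_proj0 n : p n 0 = 0.
Proof. by have := gr_projB n 0 0; rewrite !subrr. Qed.

Lemma gr_projD n : {morph p n : x y / x + y}.
Proof.
move=> x y; rewrite -[y in LHS]opprK -[- y]sub0r !gr_projB gr_proj0.
by rewrite sub0r opprK.
Qed.

Lemma gr_proj_sum n (I : Type) (r : seq I) (F : I -> V) :
  p n (\sum_(i <- r) F i) = \sum_(i <- r) p n (F i).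
Proof. exact: (big_morph (p n) (gr_projD n) (gr_proj0 n)). Qed.

Lemma gr_proj_mem n x : Vg n (p n x).
Proof. by case: gr_projP. Qed.

Lemma gr_proj_id n x : Vg n x -> p n x = x.
Proof. by case: gr_projP => _ _ pid _ /pid ->; rewrite eqxx. Qed.

Lemma gr_proj_neq n m x : Vg n x -> m != n -> p m x = 0.
Proof. by case: gr_projP => _ _ pid _ /pid -> /negPf ->. Qed.

Lemma gr_supp x : exists s, [/\ uniq s, forall n, n \notin s -> p n x = 0
                             & x = \sum_(n <- s) p n x].
Proof. by case: gr_projP. Qed.

Lemma gr_comp0 n : Vg n 0.
Proof. by rewrite -(gr_proj0 n); apply: gr_proj_mem. Qed.

Lemma gr_compB n x y : Vg n x -> Vg n y -> Vg n (x - y).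
Proof.
move=> Vx Vy; rewrite -(gr_proj_id Vx) -(gr_proj_id Vy) -gr_projB.
exact: gr_proj_mem.
Qed.

Lemma gr_compD n x y : Vg n x -> Vg n y -> Vg n (x + y).
Proof.
move=> Vx Vy; rewrite -(gr_proj_id Vx) -(gr_proj_id Vy) -gr_projD.
exact: gr_proj_mem.
Qed.

Lemma homogeneous_ind (P : V -> Prop) :
  P 0 -> (forall x y, P x -> P y -> P (x + y)) -> (forall n x, Vg n x -> P x) ->
  forall x, P x.
Proof.
move=> P0 PD Ph x; have [s [_ _ ->]] := gr_supp x.
by elim/big_ind: _ => // n _; apply: Ph; apply: gr_proj_mem.
Qed.

Lemma gr_proj_ext x y : (forall n, p n x = p n y) -> x = y.
Proof.
move=> pxy; apply/eqP; rewrite -subr_eq0; apply/eqP.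
have [s [_ _ ->]] := gr_supp (x - y).
by rewrite big1 // => n _; rewrite gr_projB pxy subrr.
Qed.

End Grading.

(** * Graded modules *)

Section GradedModules.
Variables (R : pzRingType) (Rg : int -> set R).
Implicit Types M N : gradedModule Rg.

Definition hproj M := gr_proj (gmoduleP M).1.

Lemma gcomp_scale M i j r x :
  Rg j r -> gcomp M i x -> gcomp M (i + j) (r *: x).
Proof.
have [_ aM] := gmoduleP M => Rr Mx.
by have := aM i j x r; rewrite !inE; apply.
Qed.

Lemma hprojZ M n j r (x : M) : Rg j r ->
  hproj n (r *: x) = r *: hproj (n - j) x.
Proof.
move=> Rr; move: x; apply: (homogeneous_ind (gmoduleP M).1).
- by rewrite /hproj scaler0 !gr_proj0 scaler0.
- by move=> x y hx hy; rewrite /hproj scalerDr !gr_projD scalerDr -!/(hproj _ _) hx hy.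
move=> i x Mx; have [->|nij] := eqVneq n (i + j).
  by rewrite addrK /hproj !gr_proj_id //; apply: gcomp_scale.
rewrite /hproj (gr_proj_neq _ (gcomp_scale Rr Mx)) //.
rewrite (gr_proj_neq _ Mx) ?scaler0 //.
by apply: contra nij => /eqP <-; rewrite subrK.
Qed.

Definition gsubmod M (X : set M) :=
  submod X /\ forall n x, X x -> X (hproj n x).

Lemma graded_morphismP M N (f : {linear M -> N}) :
  graded_morphism f <-> forall n x, hproj n (f x) = f (hproj n x).
Proof.
split=> [fg n x|fg n x].
  move: x; apply: (homogeneous_ind (gmoduleP M).1).
  - by rewrite linear0 /hproj !gr_proj0 linear0.
  - move=> x y hx hy.
    by rewrite linearD /hproj !gr_projD linearD -!/(hproj _ _) hx hy.
  move=> i x Mx; have Nfx : gcomp N i (f x).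
    by have := fg i x; rewrite !inE; apply.
  have [->|ni] := eqVneq n i; first by rewrite /hproj !gr_proj_id.
  by rewrite /hproj (gr_proj_neq _ Nfx) // (gr_proj_neq _ Mx) // linear0.
rewrite !inE => Mx; rewrite -(gr_proj_id (gmoduleP M).1 Mx) -fg.
exact: gr_proj_mem.
Qed.

Lemma graded_morphism_comp M N f n x : @graded_morphism R Rg M N f ->
  gcomp M n x -> gcomp N n (f x).
Proof. by move=> fg Mx; have := fg n x; rewrite !inE; apply. Qed.

Lemma gsubmod_ker M N f : @graded_morphism R Rg M N f ->
  gsubmod [set x | f x = 0].
Proof.
move=> /graded_morphismP fg; split=> [|n x /= fx0]; first exact: submod_ker.
by rewrite -fg fx0 /hproj gr_proj0.
Qed.

Lemma gsubmod_range M N f : @graded_morphism R Rg M N f -> gsubmod (range f).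
Proof.
move=> /graded_morphismP fg; split=> [|n _ [x _ <-]]; first exact: submod_range.
by rewrite fg; exists (hproj n x).
Qed.

Lemma graded_isomorphic_bij M N (f : {linear M -> N}) :
  graded_morphism f -> bijective f -> graded_isomorphic M N.
Proof.
move=> fg fb; have [g [fK gK]] := linear_bij_inv fb.
exists f, g; split=> //; apply/graded_morphismP => n y.
by apply: (can_inj fK); rewrite -(graded_morphismP f).1 // !gK.
Qed.

(** A graded kernel is what makes the images of the components independent. *)
Lemma push_grading M (Q : lmodType R) (p : {linear M -> Q}) :
  surjective p -> (forall n x, p x = 0 -> p (hproj n x) = 0) ->
  is_graded_module Rg (fun n => p @` gcomp M n).
Proof.
move=> pS pk; have [s sK] := choice pS.
have qE n x y : p x = p y -> p (hproj n x) = p (hproj n y).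
  move=> pxy; apply/eqP; rewrite -subr_eq0 -linearB -gr_projB; apply/eqP/pk.
  by rewrite linearB pxy subrr.
split; last first.
  move=> i j x r; rewrite !inE => -[y My <-] Rr.
  by exists (r *: y); [apply: gcomp_scale|rewrite linearZ].
apply: (@projection_grading _ _ (fun n y => p (hproj n (s y)))).
  move=> n; split; first by exists 0; [exact: gr_comp0 (gmoduleP M).1 n|rewrite linear0].
  move=> _ _ [x Mx <-] [y My <-]; exists (x - y); last by rewrite linearB.
  exact: gr_compB (gmoduleP M).1 _ _ _ Mx My.
split.
- move=> n x y; rewrite -linearB -gr_projB; apply: qE.
  by rewrite linearB !sK.
- by move=> n y; exists (hproj n (s y)) => //; apply: gr_proj_mem.
- move=> n _ [x Mx <-] m; rewrite (qE _ _ x) ?sK //.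
  case: eqVneq => [->|mn]; first by rewrite /hproj gr_proj_id.
  by rewrite /hproj (gr_proj_neq _ Mx) // linear0.
move=> y; have [t [ut t0 sE]] := gr_supp (gmoduleP M).1 (s y).
exists t; split=> // [n /t0 p0|]; first by rewrite /hproj p0 linear0.
by rewrite -linear_sum -sE sK.
Qed.

Lemma gquotient_ex M (X : set M) : gsubmod X ->
  exists N (p : {linear M -> N}),
    [/\ graded_morphism p, surjective p & forall x, p x = 0 <-> X x].
Proof.
move=> [sX gX]; have [Q [p [pS pk]]] := quotient_ex sX.
have gQ : is_graded_module Rg (fun n => p @` gcomp M n).
  by apply: push_grading pS _ => n x /pk Xx; apply/pk/gX.
exists (GradedModule gQ), p; split=> // n x; rewrite !inE => Mx.
by exists x.
Qed.

End GradedModules.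

(** * Homogeneous components of a linear map *)

Section GradedRing.
Variables (R : pzRingType) (Rg : int -> set R).
Hypothesis gradedR : is_graded_ring Rg.
Implicit Types X Y Z : gradedModule Rg.

Lemma mul_comp i j r s : Rg i r -> Rg j s -> Rg (i + j) (r * s).
Proof.
by have [_ mulR] := gradedR; move=> Rr Rs; have := mulR i j r s; rewrite !inE; apply.
Qed.

Lemma eq_homogeneous X (Y : lmodType R) (f g : {linear X -> Y}) :
  (forall k x, gcomp X k x -> f x = g x) -> f =1 g.
Proof.
move=> fg; apply: (homogeneous_ind (gmoduleP X).1) => //.
  by rewrite !linear0.
by move=> x y fgx fgy; rewrite !linearD fgx fgy.
Qed.

Lemma hcomp_ex X Y (f : {linear X -> Y}) n :
  exists g : {linear X -> Y}, forall k x, gcomp X k x -> g x = hproj (k + n) (f x).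
Proof.
have [s sP] := choice (gr_supp (gmoduleP X).1).
pose F k x := hproj (k + n) (f (hproj k x)).
have FD k x y : F k (x + y) = F k x + F k y.
  by rewrite /F /hproj gr_projD linearD gr_projD.
pose g x := \sum_(k <- s x) F k x.
have gE x t : uniq t -> {subset s x <= t} -> g x = \sum_(k <- t) F k x.
  move=> ut st; have [us s0 _] := sP x; rewrite [RHS](big_pad us ut st) //.
  by move=> k /s0 p0; rewrite /F /hproj p0 linear0 gr_proj0.
have gD x y : g (x + y) = g x + g y.
  pose t := undup (s (x + y) ++ (s x ++ s y)).
  have sub z : {subset z <= s (x + y) ++ (s x ++ s y)} -> {subset z <= t}.
    by move=> zt m /zt; rewrite mem_undup.
  rewrite !(gE _ t) ?undup_uniq //;
    try by apply: sub => m ms; rewrite !mem_cat ms ?orbT.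
  by rewrite -big_split; apply: eq_bigr => k _; rewrite FD.
have gh k x : gcomp X k x -> g x = hproj (k + n) (f x).
  move=> Xx; pose t := undup (k :: s x).
  rewrite (gE x t) ?undup_uniq => [||m ms]; rewrite ?mem_undup ?inE ?ms ?orbT //.
  rewrite (bigD1_seq k) ?undup_uniq ?mem_undup ?mem_head //= big1 ?addr0.
    by rewrite /F /hproj (gr_proj_id _ Xx).
  by move=> m mk; rewrite /F /hproj (gr_proj_neq _ Xx) // linear0 gr_proj0.
have g0 : g 0 = 0.
  rewrite (gh 0 0) ?linear0 /hproj ?gr_proj0 //.
  exact: gr_comp0 (gmoduleP X).1 _.
have gZ a x : g (a *: x) = a *: g x.
  move: a x; apply: (homogeneous_ind gradedR.1) => [x|a b ga gb x|j r Rr].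
  - by rewrite !scale0r.
  - by rewrite !scalerDl gD ga gb.
  apply: (homogeneous_ind (gmoduleP X).1) => [|x y gx gy|k x Xx].
  - by rewrite scaler0 g0 scaler0.
  - by rewrite scalerDr !gD scalerDr gx gy.
  rewrite (gh _ _ Xx) (gh _ _ (gcomp_scale Rr Xx)) linearZ (hprojZ _ _ Rr).
  by rewrite addrAC addrK.
have lg : linear g by move=> a x y; rewrite gD gZ.
by exists (mk_linear lg).
Qed.

Definition hcomp X Y (f : {linear X -> Y}) n := sval (cid (hcomp_ex f n)).

Lemma hcompE X Y (f : {linear X -> Y}) n k x :
  gcomp X k x -> hcomp f n x = hproj (k + n) (f x).
Proof. by move: k x; apply: (svalP (cid (hcomp_ex f n))). Qed.

Lemma hcomp_mem X Y (f : {linear X -> Y}) n k x :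
  gcomp X k x -> gcomp Y (k + n) (hcomp f n x).
Proof. by move=> Xx; rewrite (hcompE _ _ Xx); apply: gr_proj_mem. Qed.

Lemma hcomp0_graded X Y (f : {linear X -> Y}) : graded_morphism (hcomp f 0).
Proof.
by move=> k x; rewrite !inE => /(@hcomp_mem _ _ f 0); rewrite addr0.
Qed.

Lemma hcomp0_id X (f : {linear X -> X}) : f =1 id -> hcomp f 0 =1 id.
Proof.
move=> f1; apply: (@eq_homogeneous X X (hcomp f 0) idfun) => k x Xx.
by rewrite (hcompE _ _ Xx) f1 addr0 /hproj gr_proj_id.
Qed.

(** A map out of a finitely generated module has finitely many homogeneous
    components, so the degree 0 part of a composite is a finite sum. *)
Lemma hcomp_comp X Y Z (f : {linear X -> Y}) (g : {linear Y -> Z}) :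
  finitely_generated X ->
  exists s : seq int, forall x,
    hcomp (g \o f) 0 x = \sum_(n <- s) hcomp g (- n) (hcomp f n x).
Proof.
move=> /finitely_generatedP[gens gensP].
have finx (x : X) : exists s : seq int, forall n, n \notin s -> hcomp f n x = 0.
  move: x; apply: (homogeneous_ind (gmoduleP X).1).
  - by exists [::] => n _; rewrite linear0.
  - move=> x y [s sP] [t tP]; exists (s ++ t) => n.
    by rewrite mem_cat negb_or linearD => /andP[/sP-> /tP->]; rewrite addr0.
  move=> k x Xx; have [s [_ s0 _]] := gr_supp (gmoduleP Y).1 (f x).
  exists [seq j - k | j <- s] => n ns; rewrite (hcompE _ _ Xx).
  rewrite /hproj s0 //; apply: contra ns => /(map_f (fun j => j - k)).
  by rewrite addrAC subrr add0r.
have [s us sP] : exists2 s : seq int, uniq s &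
    forall n, n \notin s -> forall x, hcomp f n x = 0.
  have [t tP] := choice finx.
  exists (undup (flatten (map t gens))) => [|n]; first exact: undup_uniq.
  rewrite mem_undup => nt x.
  apply: (span_subset (submod_ker (hcomp f n)) _ (gensP x)).
  move=> y ys; apply: tP; apply: contra nt => nty.
  by apply/flattenP; exists (t y) => //; apply: map_f.
exists s.
have lin : linear (fun x => \sum_(n <- s) hcomp g (- n) (hcomp f n x)).
  move=> a x y; rewrite scaler_sumr -big_split; apply: eq_bigr => n _ /=.
  by rewrite !linearP.
apply: (@eq_homogeneous X Z _ (mk_linear lin)) => k x Xx /=.
rewrite (hcompE _ _ Xx) addr0.
have fE : f x = \sum_(n <- s) hcomp f n x.
  apply: (gr_proj_ext (gV := (gmoduleP Y).1)) => m.
  rewrite gr_proj_sum; have fm n : gcomp Y (k + n) (hcomp f n x) by apply: hcomp_mem.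
  have off n : n != m - k -> gr_proj (gmoduleP Y).1 m (hcomp f n x) = 0.
    move=> nm; rewrite (gr_proj_neq _ (fm n)) //.
    by apply: contra nm => /eqP->; rewrite addrAC subrr add0r.
  have on : gr_proj (gmoduleP Y).1 m (f x) = hcomp f (m - k) x.
    by rewrite (hcompE _ _ Xx) addrC subrK.
  have [ms|ms] := boolP (m - k \in s).
    rewrite (bigD1_seq (m - k)) //= big1 ?addr0 => [|n /off//].
    by rewrite on gr_proj_id //; have := fm (m - k); rewrite addrC subrK.
  rewrite on sP // big1_seq // => n /= ns; apply: off.
  by apply: contraNneq ms => <-.
rewrite /= fE linear_sum /hproj gr_proj_sum; apply: eq_bigr => n _.
by rewrite (hcompE _ _ (hcomp_mem f n Xx)) addrK.
Qed.

(** * Graded free modules and homogeneous generators *)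

Definition free_comp n (d : 'I_n -> int) : int -> set 'rV[R]_n :=
  fun k => [set v | forall j, Rg (k - d j) (v 0 j)].

Lemma free_is_graded n (d : 'I_n -> int) : is_graded_module Rg (free_comp d).
Proof.
split; last first.
  move=> i j v r; rewrite !inE => vi Rr k; rewrite mxE.
  by rewrite addrAC addrC; apply: mul_comp.
pose p k (v : 'rV[R]_n) : 'rV[R]_n := \row_j gr_proj gradedR.1 (k - d j) (v 0 j).
apply: (@projection_grading _ _ p).
  move=> k; split=> [j|x y xk yk j]; rewrite !mxE; first exact: gr_comp0 gradedR.1 _.
  exact: gr_compB gradedR.1 _ _ _ (xk j) (yk j).
split.
- by move=> k x y; apply/rowP => j; rewrite !mxE gr_projB.
- by move=> k x j; rewrite mxE; apply: gr_proj_mem.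
- move=> k x xk m; apply/rowP => j; rewrite !mxE.
  case: eqVneq => [->|mk]; first by rewrite gr_proj_id.
  rewrite (gr_proj_neq _ (xk j)) ?mxE //.
  by apply: contra mk => /eqP/addIr->.
move=> x.
have /choice[s sP] : forall j, exists s : seq int, [/\ uniq s,
    forall m, m \notin s -> gr_proj gradedR.1 m (x 0 j) = 0
    & x 0 j = \sum_(m <- s) gr_proj gradedR.1 m (x 0 j)].
  by move=> j; apply: gr_supp.
pose t := undup (flatten [seq [seq m + d j | m <- s j] | j <- enum 'I_n]).
have mt j m : m \in s j -> m + d j \in t.
  move=> ms; rewrite mem_undup; apply/flattenP; exists [seq m + d j | m <- s j].
    by apply: (map_f (fun j => [seq m + d j | m <- s j])); rewrite mem_enum.
  exact: map_f.
exists t; split; first exact: undup_uniq.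
  move=> k kt; apply/rowP => j; rewrite !mxE; have [_ s0 _] := sP j.
  by apply: s0; apply: contra kt => /mt; rewrite subrK.
apply/rowP => j; have [us s0 ->] := sP j; rewrite summxE.
under [RHS]eq_bigr => k _ do rewrite mxE.
rewrite -(big_map (fun k => k - d j) xpredT (fun m => gr_proj gradedR.1 m (x 0 j))).
rewrite [RHS](big_pad us) //.
  by rewrite map_inj_uniq ?undup_uniq //; apply: addIr.
by move=> m /mt /(map_f (fun k => k - d j)); rewrite addrK.
Qed.

Definition gfree n (d : 'I_n -> int) : gradedModule Rg :=
  GradedModule (free_is_graded d).

End GradedRing.

Section Combinations.
Variables (R : pzRingType) (M : lmodType R).

Definition comb n (g : 'I_n -> M) (v : 'rV[R]_n) := \sum_j v 0 j *: g j.

Fact comb_linear n (g : 'I_n -> M) : linear (comb g).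
Proof.
move=> a u v; rewrite /comb scaler_sumr -big_split; apply: eq_bigr => j _.
by rewrite !mxE /= scalerDl scalerA.
Qed.
HB.instance Definition _ n (g : 'I_n -> M) :=
  GRing.isLinear.Build R 'rV[R]_n M *:%R (comb g) (@comb_linear n g).

Lemma fg_rV n : finitely_generated ('rV[R]_n : lmodType R).
Proof.
exists n, (fun j => delta_mx 0 j) => v; exists (v 0).
by rewrite {1}(row_sum_delta v).
Qed.

End Combinations.

(** * Endomorphisms of graded indecomposable modules *)

Section HomogeneousGenerators.
Variables (R : pzRingType) (Rg : int -> set R).
Implicit Types M N : gradedModule Rg.

Lemma homogeneous_generators M (X : set M) : gsubmod X -> fg X ->
  exists n (d : 'I_n -> int) (g : 'I_n -> M),
    [/\ forall j, gcomp M (d j) (g j), forall j, g j <> 0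
      & forall x, X x <-> exists v, x = comb g v].
Proof.
move=> [sX gX] [s0 s0P].
have [s [sM sX' sgen]] : exists s : seq (int * M),
    [/\ forall u, u \in s -> gcomp M u.1 u.2 /\ u.2 <> 0,
        forall u, u \in s -> X u.2
      & forall x, x \in s0 -> span (unzip2 s) x].
  have : forall x, x \in s0 -> X x by move=> x xs; apply/s0P/mem_span.
  elim: s0 {s0P} => [_|x s0 IHs s0X]; first by exists [::].
  have [|s [sM sX' sgen]] := IHs; first by move=> y ys; apply: s0X; rewrite inE ys orbT.
  have Xx : X x by apply: s0X; apply: mem_head.
  have [t [_ _ xE]] := gr_supp (gmoduleP M).1 x.
  pose u := [seq w <- [seq (n, hproj n x) | n <- t] | w.2 != 0].
  have uP w : w \in u -> w.2 <> 0 /\ exists n, w = (n, hproj n x).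
    by rewrite mem_filter => /andP[/eqP w0 /mapP[n _ wE]]; split; last by exists n.
  exists (u ++ s); split=> [w|w|y].
  - rewrite mem_cat => /orP[/uP[w0 [n wE]]|/sM//].
    by split=> //; rewrite wE /=; apply: gr_proj_mem.
  - by rewrite mem_cat => /orP[/uP[_ [n ->]]|/sX'//]; apply: gX.
  rewrite inE /unzip2 map_cat => /predU1P[->|/sgen]; last first.
    by apply: span_mono => w ws; rewrite mem_cat ws orbT.
  have sS := submod_span ([seq i.2 | i <- u] ++ [seq i.2 | i <- s]).
  rewrite xE big_seq; elim/big_ind: _ => [|a b|n nt]; first exact: submod0.
    exact: submodD.
  have [->|n0] := eqVneq (gr_proj (gmoduleP M).1 n x) 0; first exact: submod0.
  apply: mem_span; rewrite mem_cat; apply/orP; left.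
  apply/mapP; exists (n, hproj n x) => //; rewrite mem_filter n0 /=.
  by apply/mapP; exists n.
have sE x : X x <-> span (unzip2 s) x.
  split; first by move=> /s0P; apply: span_subset; [apply: submod_span|].
  by apply: span_subset => // y /mapP[u us ->]; apply: sX'.
exists (size s), (fun i => (nth (0, 0) s i).1), (fun i => (nth (0, 0) s i).2).
split=> [j|j|x]; try by have [] := sM _ (mem_nth (0, 0) (ltn_ord j)).
split=> [/sE|[v ->]].
  elim: {sE sgen sM sX'} s x => [|u s IHs] x /=.
    by move=> ->; exists 0; rewrite linear0.
  move=> [c /IHs[v xE]]; exists (\row_i oapp (v 0) c (unlift ord0 i)).
  rewrite /comb big_ord_recl mxE unlift_none /= -[LHS](subrK (c *: u.2)) xE addrC.
  by congr (_ + _); apply: eq_bigr => i _; rewrite mxE liftK.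
apply: submod_sum => // i; apply: submodZ => //.
by apply: sX'; apply: mem_nth.
Qed.

End HomogeneousGenerators.

Section Fitting.
Variables (R : pzRingType) (Rg : int -> set R).
Hypothesis artR : left_artinian R.
Implicit Types M N : gradedModule Rg.

Fixpoint lpow (M : lmodType R) (f : {linear M -> M}) n : {linear M -> M} :=
  if n is k.+1 then f \o lpow f k else idfun.

Lemma lpowE (M : lmodType R) (f : {linear M -> M}) n x : lpow f n x = iter n f x.
Proof. by elim: n => //= n ->. Qed.

Lemma lpow_graded M (f : {linear M -> M}) n :
  graded_morphism f -> graded_morphism (lpow f n).
Proof.
move=> fg; elim: n => [//|n IHn k x /= /(IHn k)]; exact: fg.
Qed.

Lemma iter_linear0 (M : lmodType R) (f : {linear M -> M}) n : iter n f 0 = 0.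
Proof. by rewrite -lpowE linear0. Qed.

Lemma kernels_stabilize (M : lmodType R) (f : {linear M -> M}) :
  noetherian M -> exists n, forall m, (n <= m)%N ->
    forall x, iter m f x = 0 -> iter n f x = 0.
Proof.
move=> noeM.
have [||X [[n ->] maxX]] := @noetherian_maximal _ _
    (fun X : set M => exists n, X = [set x | iter n f x = 0])
    [set x | iter 0 f x = 0] noeM.
- move=> _ [n ->].
  by have := submod_ker (lpow f n); under eq_fun do rewrite lpowE.
- by exists 0%N.
exists n => m lenm x xm.
have kE : [set x | iter m f x = 0] = [set x | iter n f x = 0].
  apply: maxX; first by exists m.
  by move=> y /= yn; rewrite -(subnK lenm) iterD yn iter_linear0.
have : [set x | iter m f x = 0] x by [].
by rewrite kE.
Qed.

Lemma images_stabilize (M : lmodType R) (f : {linear M -> M}) :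
  artinian_module M -> exists n, forall m, (n <= m)%N ->
    forall x, exists y, iter n f x = iter m f y.
Proof.
move=> artM.
have [||X [[n ->] minX]] := @artinian_minimal _ _
    (fun X : set M => exists n, X = range (iter n f)) (range (iter 0 f)) artM.
- move=> _ [n ->]; have := submod_range (lpow f n).
  by rewrite (_ : (lpow f n : M -> M) = iter n f) //; apply/funext => x; rewrite lpowE.
- by exists 0%N.
exists n => m lenm x.
have rE : range (iter m f) = range (iter n f).
  apply: minX; first by exists m.
  by move=> _ [y _ <-]; exists (iter (m - n) f y); rewrite // -iterD subnKC.
have : range (iter n f) (iter n f x) by exists x.
by rewrite -rE => -[y _ <-]; exists y.
Qed.

(** Fitting's lemma: M is the direct sum of the kernel and the range of a high
    power of f, which are graded submodules, so one of them is zero. The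
    summands are taken as quotients of M by each other. *)
Lemma fitting M (f : {linear M -> M}) :
  finitely_generated M -> graded_indecomposable M -> graded_morphism f ->
  bijective f \/ exists n, forall x, iter n f x = 0.
Proof.
move=> fgM [_ indM] fgr.
have [n1 kerP] := kernels_stabilize f (noetherian_fg artR fgM).
have [n2 imP] := images_stabilize f (artinian_fg artR fgM).
pose n := (maxn n1 n2).+1; pose h := lpow f n.
have len1 : (n1 <= n)%N by rewrite /n; lia.
have len2 : (n2 <= n)%N by rewrite /n; lia.
have hh x : h (h x) = 0 -> h x = 0.
  rewrite /h !lpowE -iterD => /kerP-/(_ ltac:(lia)) kx.
  by rewrite -(subnK len1) iterD kx iter_linear0.
have him x : exists y, h x = h (h y).
  have [y xE] := imP (n + n)%N ltac:(lia) x; exists (iter (n - n2) f y).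
  rewrite /h !lpowE -[in LHS](subnK len2) iterD xE -!iterD.
  by congr (iter _ f _); lia.
have hgr : graded_morphism h by apply: lpow_graded.
have [N1 [p1 [p1g p1S p1k]]] := gquotient_ex (gsubmod_ker hgr).
have [N2 [p2 [p2g p2S p2k]]] := gquotient_ex (gsubmod_range hgr).
have lphi : linear (fun x => (p1 x, p2 x) : graded_dsum N1 N2).
  by move=> a x y; rewrite !linearP.
pose phi : {linear M -> graded_dsum N1 N2} := mk_linear lphi.
have phig : graded_morphism phi.
  by move=> k x Mx; rewrite inE /=; split; [apply: p1g|apply: p2g].
have phib : bijective phi.
  apply: inj_surj_bij.
    apply: linear_inj => x [/p1k /= hx /p2k[y _ yE]].
    by rewrite -yE; apply: hh; rewrite yE.
  have split x : exists y, h (x - h y) = 0.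
    by have [y xE] := him x; exists y; rewrite linearB xE subrr.
  move=> [c1 c2]; have [a <-] := p1S c1; have [b <-] := p2S c2.
  have [a' ha] := split a; have [b' hb] := split b.
  exists (h a' + (b - h b')).
  congr pair; apply/eqP; rewrite -subr_eq0 -linearB; apply/eqP.
    apply/p1k; suff : h (h a' + (b - h b') - a) = 0 by [].
    have -> : h a' + (b - h b') - a = (b - h b') - (a - h a').
      by rewrite opprB [h a' + _]addrC addrA.
    by rewrite linearB hb ha subrr.
  apply/p2k; exists (a' - b') => //; rewrite linearB.
  by rewrite -addrA [b - _ - _]addrAC subrr sub0r.
have [N1z|N2z] := indM N1 N2 (graded_isomorphic_bij phig phib).
  by right; exists n => x; rewrite -lpowE; apply/p1k.
left; have hS x : exists y, h y = x.
  by have /p2k[y _ <-] := N2z (p2 x); exists y.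
apply: inj_surj_bij.
  apply: linear_inj => x fx; have [y yE] := hS x.
  rewrite -yE; apply: hh; rewrite yE /h lpowE /n iterSr fx; exact: iter_linear0.
by move=> x; have [y <-] := hS x; exists (lpow f n.-1 y).
Qed.

(** The degree 0 endomorphisms of an indecomposable module form a local ring: by
    Fitting's lemma two of them that add up to the identity cannot both be
    nilpotent. *)
Lemma graded_local M (f g h : {linear M -> M}) :
  finitely_generated M -> graded_indecomposable M ->
  graded_morphism f -> graded_morphism g -> graded_morphism h ->
  bijective h -> (forall x, h x = f x + g x) -> bijective f \/ bijective g.
Proof.
move=> fgM indM fgr ggr hgr hb hE.
have [u [hK uK]] := linear_bij_inv hb.
have ugr : graded_morphism u.
  apply/graded_morphismP => k x; apply: (can_inj hK).
  by rewrite -(graded_morphismP h).1 // !uK.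
have bij_of (f' : {linear M -> M}) : bijective (u \o f') -> bijective f'.
  move=> ub; apply: (@eq_bij _ _ (h \o (u \o f'))); first exact: bij_comp.
  by move=> x /=; rewrite uK.
have compg (f' : {linear M -> M}) : graded_morphism f' -> graded_morphism (u \o f').
  by move=> f'g k x Mx; apply: ugr; apply: f'g.
have [fb|[n fn]] := fitting fgM indM (compg f fgr); first by left; apply: bij_of.
have [gb|[m gm]] := fitting fgM indM (compg g ggr); first by right; apply: bij_of.
have ginj : injective (u \o g).
  apply: linear_inj => x /= ugx.
  have fx : (u \o f) x = x.
    by rewrite /= -[RHS]hK hE linearD ugx addr0.
  by rewrite -(fn x); elim: {fn} n => //= n <-; rewrite -[LHS]fx.
case: indM => M0 _; case: M0 => x.
have : iter m (u \o g) x = iter m (u \o g) 0 by rewrite gm iter_linear0.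
by elim: {gm} m => //= m IHm /ginj.
Qed.

Lemma graded_local_sum M (s : seq int) (f : int -> {linear M -> M})
    (h : {linear M -> M}) :
  finitely_generated M -> graded_indecomposable M ->
  (forall n, graded_morphism (f n)) -> graded_morphism h -> bijective h ->
  (forall x, h x = \sum_(n <- s) f n x) -> exists n, bijective (f n).
Proof.
move=> fgM indM fg; elim: s h => [|a s IHs] h hg hb hE.
  case: indM => M0 _; case: M0 => x; apply: (bij_inj hb).
  by rewrite !hE !big_nil.
have lg : linear (fun x => \sum_(n <- s) f n x).
  move=> c x y; rewrite scaler_sumr -big_split; apply: eq_bigr => n _ /=.
  by rewrite linearP.
have gg : graded_morphism (mk_linear lg).
  move=> k x Mx; rewrite inE /=; elim/big_ind: _ => [|y z My Mz|n _].
  - exact: gr_comp0 (gmoduleP M).1 k.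
  - exact: gr_compD (gmoduleP M).1 _ _ _ My Mz.
  by have := fg n k x Mx; rewrite inE.
have [|ab|gb] := graded_local fgM indM (fg a) gg hg hb.
- by move=> x; rewrite hE big_cons.
- by exists a.
exact: IHs _ gg gb _.
Qed.

(** Decomposition into graded indecomposable modules, as an induction
    principle: a submodule maximal among those with a bad quotient would have
    a decomposable quotient whose summands are good. *)
Lemma graded_decomposition_ind (Phi : gradedModule Rg -> Prop) :
  (forall M, zero_module M -> Phi M) ->
  (forall M, finitely_generated M -> graded_indecomposable M -> Phi M) ->
  (forall M N1 N2, graded_isomorphic M (graded_dsum N1 N2) ->
     Phi N1 -> Phi N2 -> Phi M) ->
  forall M, finitely_generated M -> Phi M.
Proof.
move=> Phi0 Phi_ind Phi_sum M fgM; apply: contrapT => nPhiM.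
pose good (X : set M) := forall N (p : {linear M -> N}), graded_morphism p ->
  surjective p -> (forall x, p x = 0 <-> X x) -> Phi N.
have [||X [[gX nX] maxX]] := @noetherian_maximal _ _
    (fun X => gsubmod X /\ ~ good X) [set 0] (noetherian_fg artR fgM).
- by move=> X [[]].
- split; first by split; [exact: submod_zero|move=> n x ->; rewrite /= /hproj gr_proj0].
  by move=> /(_ M idfun) good0; apply: nPhiM; apply: good0 => // y; exists y.
apply: nX => N p pg pS pk; apply: contrapT => nPhiN.
have fgN : finitely_generated N by apply: fg_image pS fgM.
have [N1 [N2 [isoN N1z N2z]]] : exists N1 N2,
    [/\ graded_isomorphic N (graded_dsum N1 N2), ~ zero_module N1 & ~ zero_module N2].
  apply: contrapT => noN; apply: (nPhiN); apply: Phi_ind => //.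
  split=> [Nz|N1 N2 isoN]; first by apply: (nPhiN); apply: Phi0.
  have [|N1z] := pselect (zero_module N1); first by left.
  have [|N2z] := pselect (zero_module N2); first by right.
  by case: noN; exists N1, N2.
have proper N' (q : {linear N -> N'}) : graded_morphism q -> surjective q ->
    (exists2 y, y <> 0 & q y = 0) -> Phi N'.
  move=> qg qS [y y0 qy]; apply: contrapT => nPhiN'.
  have qpg : graded_morphism (q \o p) by move=> k x /(pg k)/(qg k).
  have kX : [set x | q (p x) = 0] = X.
    apply: maxX; last by move=> x /pk px; rewrite /= px linear0.
    split; first exact: (gsubmod_ker qpg).
    move=> good_q; apply: nPhiN'; apply: (good_q N' (q \o p)) => // z.
    by have [w <-] := qS z; have [x <-] := pS w; exists x.
  have [x xE] := pS y; apply: y0; rewrite -xE; apply/pk.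
  by rewrite -kX /= xE.
have [phi [psi [phig _ phiK psiK]]] := isoN.
have [/existsNP[y1 y1z] /existsNP[y2 y2z]] := (N1z, N2z).
have psi0 y : y <> 0 -> psi y <> 0.
  by move=> y0 /(canRL psiK); rewrite linear0.
apply: nPhiN; apply: Phi_sum isoN _ _.
  have lp : linear (fun x => (phi x).1) by move=> a x y; rewrite !linearP.
  apply: (proper N1 (mk_linear lp)).
  - by move=> k x /(phig k); rewrite [X in X -> _]inE => -[].
  - by move=> y; exists (psi (y, 0)); rewrite /= psiK.
  - by exists (psi (0, y2)); [apply: psi0 => -[]|rewrite /= psiK].
have lp : linear (fun x => (phi x).2) by move=> a x y; rewrite !linearP.
apply: (proper N2 (mk_linear lp)).
- by move=> k x /(phig k); rewrite [X in X -> _]inE => -[].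
- by move=> y; exists (psi (0, y)); rewrite /= psiK.
- by exists (psi (y1, 0)); [apply: psi0 => -[]|rewrite /= psiK].
Qed.

End Fitting.

(** * Cancellation *)

(** The grading concentrated in degree 0 makes the results on graded modules
    available for ungraded ones. *)
Definition triv_comp (V : zmodType) : int -> set V :=
  fun n => if n == 0 then setT else [set 0].
Arguments triv_comp : clear implicits.

Lemma triv_compE (V : zmodType) n (x : V) : triv_comp V n x <-> n = 0 \/ x = 0.
Proof.
rewrite /triv_comp; case: eqP => [->|n0]; split=> //.
- by left.
- by move=> ->; right.
- by case.
Qed.

Lemma triv_grading (V : zmodType) : is_grading (triv_comp V).
Proof.
apply: (@projection_grading _ _ (fun n x => if n == 0 then x else 0)).
  move=> n; split=> [|x y]; rewrite !triv_compE; first by right.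
  by case=> [->|->]; [left|case=> ->; [left|right; rewrite subr0]].
split.
- by move=> n x y; case: ifP => // _; rewrite subr0.
- by move=> n x; rewrite triv_compE; case: eqP; [left|right].
- move=> n x /triv_compE[->//|-> m]; by do 2!case: ifP.
move=> x; exists [:: 0]; split=> // [n|]; first by rewrite inE => /negPf->.
by rewrite big_seq1.
Qed.

Lemma triv_graded_ring (R : pzRingType) : is_graded_ring (triv_comp R).
Proof.
split=> [|i j r s]; first exact: triv_grading.
rewrite !inE !triv_compE => -[->|->]; last by rewrite mul0r; right.
by case=> ->; [left|right; rewrite mulr0].
Qed.

Section Trivial.
Variables (R : pzRingType) (M : lmodType R).

Fact triv_graded_module : @is_graded_module R (triv_comp R) M (triv_comp M).
Proof.
split=> [|i j x r]; first exact: triv_grading.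
rewrite !inE !triv_compE => -[->|->]; last by rewrite scaler0; right.
by case=> ->; [left|right; rewrite scale0r].
Qed.

Definition triv_module := GradedModule triv_graded_module.

End Trivial.

Section Cancellation.
Variables (R : pzRingType).

(** The Schur complement of an invertible block of an isomorphism. *)
Lemma cancel_bijective_block (A B C : lmodType R)
    (theta : {linear (A * B)%type -> (A * C)%type}) :
  bijective theta -> bijective (projl \o theta \o injl) -> iso B C.
Proof.
move=> thb alphab.
have [theta' [thK th'K]] := linear_bij_inv thb.
have [u [uK Ku]] := linear_bij_inv (f := projl \o theta \o injl) alphab.
pose t : {linear B -> A} := u \o (projl \o theta \o injr).
have thE a b : projl (theta (a, b)) = projl (theta (injl a)) + projl (theta (injr b)).
  by rewrite [(a, b)]pair_inj !linearD.
have t0 b : projl (theta (- t b, b)) = 0.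
  by rewrite thE !linearN [_ (_ (_ (t b)))]Ku addNr.
have tE a b : projl (theta (a, b)) = 0 -> a = - t b.
  rewrite thE => /eqP; rewrite addr_eq0 => /eqP aE.
  by rewrite -[LHS]uK [X in u X]aE linearN.
have ls : linear (fun b => projr (theta (- t b, b))).
  move=> c x y.
  have -> : (- t (c *: x + y), c *: x + y) = c *: (- t x, x) + (- t y, y).
    by rewrite linearP opprD -scalerN.
  by rewrite !linearP.
exists (mk_linear ls); apply: inj_surj_bij.
  apply: linear_inj => b /= tb0.
  have : theta (- t b, b) = theta 0.
    by rewrite linear0; apply: injective_projections; [apply: t0|apply: tb0].
  by move=> /(can_inj thK)[].
move=> c; case tE' : (theta' (0, c)) => [a b]; exists b.
have thE' : theta (a, b) = (0, c) by rewrite -tE' th'K.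
by rewrite /= -(tE a b) thE'.
Qed.

(** Finitely generated modules over an artinian ring cancel from direct sums:
    an indecomposable one has a local endomorphism ring, in which an
    elementary operation makes the diagonal block of the isomorphism
    invertible. *)
Lemma cancellation (A B C : lmodType R) : left_artinian R ->
  finitely_generated A -> iso (A * B)%type (A * C)%type -> iso B C.
Proof.
move=> artR fgA.
(* a graded module over the trivially graded ring may have components in all
   degrees; only those in degree 0 have all their linear maps graded *)
pose Phi (N : gradedModule (triv_comp R)) := (forall x, gcomp N 0 x) ->
  forall B C : lmodType R, iso (N * B)%type (N * C)%type -> iso B C.
have Phi_iso : Phi (triv_module A) -> iso (A * B)%type (A * C)%type -> iso B C.
  by apply=> x; apply/triv_compE; left.
apply: Phi_iso; move: (fgA : finitely_generated (triv_module A)).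
move: (triv_module A); apply: graded_decomposition_ind => {A B C fgA} //.
- move=> N Nz _ B C isoBC; apply: iso_trans (iso_trans isoBC (iso_pair0 _ Nz)).
  exact/iso_sym/iso_pair0.
- move=> N fgN indN N0 B C [theta thb].
  have gr (f : {linear N -> N}) : graded_morphism f.
    move=> n x; rewrite !inE; have [->//|n0 Nx] := eqVneq n 0.
    have -> : x = 0 by rewrite -(gr_proj_id (gmoduleP N).1 Nx) (gr_proj_neq _ (N0 x)).
    by rewrite linear0; apply: gr_comp0 (gmoduleP N).1 n.
  have [theta' [thK th'K]] := linear_bij_inv thb.
  pose alpha : {linear N -> N} := projl \o theta \o injl.
  pose bc : {linear C -> N} := projl \o theta' \o injr.
  pose aa : {linear N -> N} := projl \o theta' \o injl \o alpha.
  pose bg : {linear N -> N} := bc \o projr \o theta \o injl.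
  have one a : a = aa a + bg a.
    by rewrite /= -!linearD -pair_inj thK.
  have [aab|bgb] := graded_local artR fgN indN (gr aa) (gr bg) (gr idfun)
      (inv_bij (fun=> erefl)) one.
    have [ab|[n an]] := fitting artR fgN indN (gr alpha).
      exact: cancel_bijective_block thb ab.
    have ainj : injective alpha.
      apply: linear_inj => x ax; apply: (bij_inj aab).
      have -> : aa x = (projl \o theta' \o injl) (alpha x) by [].
      by rewrite ax !linear0.
    case: indN => Nz _; case: Nz => x; have := an x.
    elim: n {an} => [//|n IHn anx]; apply: IHn; apply: ainj.
    by rewrite linear0; exact: anx.
  have [ab|nab] := pselect (bijective alpha).
    exact: cancel_bijective_block thb ab.
  (* adding bc times the second row makes the block alpha + bc * gamma, which
     is invertible as alpha is not and the product is *)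
  have lt : linear (fun x : (N * C)%type => (x.1 + bc x.2, x.2) : (N * C)%type).
    move=> c x y; have -> : (c *: x + y).2 = c *: x.2 + y.2 by [].
    rewrite linearP; apply: injective_projections => //=.
    by rewrite scalerDr addrACA.
  have taub : bijective (mk_linear lt).
    by exists (fun x => (x.1 - bc x.2, x.2)) => -[x y] /=; rewrite ?addrK ?subrK.
  apply: (@cancel_bijective_block _ _ _ (mk_linear lt \o theta)).
    exact: bij_comp.
  have ls : linear (fun a => alpha a + bg a).
    by move=> c x y; rewrite !linearP scalerDr addrACA.
  have ln : linear (fun a => - alpha a) by move=> c x y; rewrite linearP opprD scalerN.
  have [|//|nb] := graded_local artR fgN indN (gr (mk_linear ls))
    (gr (mk_linear ln)) (gr bg) bgb.
    by move=> x; rewrite /= [alpha x + _]addrC addrK.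
  case: nab; apply: (@eq_bij _ _ (-%R \o (-%R \o alpha))).
    by apply: bij_comp nb; exists -%R; apply: opprK.
  by move=> a; rewrite /= opprK.
- move=> N N1 N2 [f [g [fg gg fK gK]]] Phi1 Phi2 N0 B C isoBC.
  have comp0 y : gcomp (graded_dsum N1 N2) 0 y.
    by rewrite -(gK y); apply: graded_morphism_comp.
  apply: Phi2; first by move=> y; have [_] := comp0 (0, y); rewrite inE.
  apply: Phi1; first by move=> y; have [] := comp0 (y, 0); rewrite inE.
  have iN (D : lmodType R) : iso (N * D)%type (N1 * (N2 * D))%type.
    apply: iso_trans (iso_pairA _ _ _); apply: iso_pairl.
    by exists f; exists g.
  by apply: iso_trans (iso_trans (iso_sym (iN B)) isoBC) (iN C).
Qed.

End Cancellation.

(** * Removing a graded summand *)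

Section GradableSummand.
Variables (R : pzRingType) (Rg : int -> set R).
Hypotheses (gradedR : is_graded_ring Rg) (artR : left_artinian R).
Implicit Types P X : gradedModule Rg.

Lemma graded_range_hcomp P X (f : {linear P -> X}) n :
  gsubmod (range (hcomp gradedR f n)).
Proof.
split=> [|m _ [x _ <-]]; first exact: submod_range.
exists (hproj (m - n) x) => //; move: x; apply: (homogeneous_ind (gmoduleP P).1).
- by rewrite /hproj linear0 !gr_proj0 linear0.
- by move=> x y hx hy; rewrite /hproj linearD !gr_projD linearD -!/(hproj _ _) hx hy.
move=> k x Px; have fx := hcomp_mem gradedR f n Px.
have [->|mk] := eqVneq m (k + n); first by rewrite addrK /hproj !gr_proj_id.
rewrite /hproj (gr_proj_neq _ fx) // (gr_proj_neq _ Px) ?linear0 //.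
by apply: contra mk => /eqP <-; rewrite subrK.
Qed.

(** For P indecomposable, write the identity of P as a map s into X followed by
    a map q out of X. Its degree 0 part is the sum of the q_(-n) s_n, so one of
    them is invertible as the degree 0 endomorphisms of P form a local ring.
    Hence s_n splits off a shift of P from X as a graded module, with a graded
    complement X', and M is isomorphic to X' by cancellation. *)
Lemma gradable_summand P X (M : lmodType R) :
  finitely_generated P -> finitely_generated X ->
  iso (P * M)%type X -> gradable Rg M.
Proof.
pose Phi P := forall X (M : lmodType R), finitely_generated X ->
  iso (P * M)%type X -> gradable Rg M.
suff : forall P, finitely_generated P -> Phi P.
  by move=> PhiP fgP fgX; apply: PhiP.
apply: graded_decomposition_ind => // {P X M}.
- move=> P Pz X M fgX isoX; exists X.
  exact: iso_trans (iso_sym (iso_pair0 M Pz)) isoX.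
- move=> P fgP indP X M fgX [phi phib].
  have [phi' [phiK phi'K]] := linear_bij_inv phib.
  pose s : {linear P -> X} := phi \o injl.
  pose q : {linear X -> P} := projl \o phi'.
  have [t tP] := hcomp_comp gradedR s q fgP.
  have id0 : hcomp gradedR (q \o s) 0 =1 id.
    by apply: hcomp0_id => x; rewrite /= phiK.
  have ug n : graded_morphism (hcomp gradedR q (- n) \o hcomp gradedR s n).
    move=> k x; rewrite !inE => Px.
    by have := hcomp_mem gradedR q (- n) (hcomp_mem gradedR s n Px); rewrite addrK.
  have [n ub] := graded_local_sum artR fgP indP ug
    (hcomp0_graded gradedR (q \o s)) (eq_bij (inv_bij (fun=> erefl)) (fsym id0)) tP.
  pose sn := hcomp gradedR s n; pose w := hcomp gradedR q (- n).
  have [u [uK Ku]] := linear_bij_inv ub.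
  have [X' [p [pg pS pk]]] := gquotient_ex (graded_range_hcomp s n).
  have lpsi : linear (fun x => (w x, p x) : (P * X')%type).
    by move=> a x y; rewrite !linearP.
  exists X'; apply: (cancellation artR fgP).
  apply: (@iso_trans _ _ X); first by exists phi.
  exists (mk_linear lpsi); apply: inj_surj_bij.
    apply: linear_inj => x [wx /pk[y _ yx]].
    rewrite -yx; suff -> : y = 0 by rewrite linear0.
    by apply: (bij_inj ub); rewrite linear0 -[RHS]wx -yx.
  move=> [a c]; have [b <-] := pS c; exists (b + sn (u (a - w b))).
  congr pair.
    by rewrite linearD [w (sn _)]Ku addrC subrK.
  rewrite linearD; have -> : p (sn (u (a - w b))) = 0 by apply/pk; exists (u (a - w b)).
  by rewrite addr0.
move=> P N1 N2 [f [g [_ _ fK gK]]] Phi1 Phi2 X M fgX isoX.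
have isoN : iso (N1 * (N2 * M))%type X.
  apply: iso_trans isoX; apply: iso_sym; apply: iso_trans (iso_pairA _ _ _).
  by apply: iso_pairl; exists f; exists g.
have [X2 isoX2] := Phi1 _ _ fgX isoN.
apply: (Phi2 X2 M _ isoX2).
have [h /bij_surj hS] := iso_sym isoN.
have [h2 /bij_surj h2S] := isoX2.
apply: (fg_image (f := h2 \o (projr \o h))) fgX => y.
have [z <-] := h2S y; have [x xE] := hS (0, z).
by exists x; rewrite /= xE.
Qed.

End GradableSummand.

(** * Presentations and their transposes *)

Section Presentations.
Variable R : pzRingType.
Implicit Types T : lmodType R.

Definition presents T m n (A : 'M[R]_(m, n)) :=
  exists p : {linear 'rV[R]_n -> T},
    surjective p /\ forall v, p v = 0 <-> exists u, v = u *m A.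

Lemma presents_iso T T' m n (A : 'M[R]_(m, n)) :
  iso T T' -> presents T A -> presents T' A.
Proof.
move=> [f fb] [p [pS pk]]; exists (f \o p); split.
  move=> y; have [x <-] := bij_surj fb y; have [v <-] := pS x; by exists v.
move=> v; rewrite -pk /=; split=> [fpv|->]; last by rewrite linear0.
by apply: (bij_inj fb); rewrite fpv linear0.
Qed.

Lemma iso_same_ker (V N N' : lmodType R) (f : {linear V -> N}) (g : {linear V -> N'}) :
  surjective f -> surjective g -> (forall x, f x = 0 <-> g x = 0) -> iso N N'.
Proof.
move=> fS gS fg.
have [h hE] := linear_factor fS (fun x => (fg x).1).
have [h' h'E] := linear_factor gS (fun x => (fg x).2).
exists h; exists h' => y.
  by have [x <-] := fS y; rewrite hE h'E.
by have [x <-] := gS y; rewrite h'E hE.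
Qed.

(** The two sides are presented by the block rows (C 0) and (0 D), and column
    operations turn both into (C D). *)
Lemma stable_iso_same_columns T T' k m n (C : 'M[R]_(k, m)) (D : 'M[R]_(k, n)) G H :
  C = D *m G -> D = C *m H -> presents T C -> presents T' D ->
  iso (T * 'rV[R]_n)%type (T' * 'rV[R]_m)%type.
Proof.
move=> CE DE [p [pS pk]] [q [qS qk]].
pose V : lmodType R := ('rV[R]_m * 'rV[R]_n)%type.
have lf : linear (fun v : V => (p v.1, v.2) : (T * 'rV[R]_n)%type).
  by move=> a x y; rewrite linearP.
pose z (v : V) := v.2 + v.1 *m H.
have lz : linear z.
  by move=> a x y; rewrite /z mulmxDl -scalemxAl scalerDr addrACA.
have lg : linear (fun v : V => (q (z v), v.1 - z v *m G) : (T' * 'rV[R]_m)%type).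
  move=> a x y; rewrite lz linearP mulmxDl -scalemxAl.
  by apply: injective_projections => //=; rewrite opprD addrACA scalerBr.
apply: (@iso_same_ker _ _ _ (mk_linear lf) (mk_linear lg)).
- by move=> [t v]; have [x <-] := pS t; exists (x, v).
- move=> [t v]; have [x <-] := qS t.
  exists (v + x *m G, x - (v + x *m G) *m H).
  by rewrite /= /z /= subrK addrK.
move=> [x y] /=; split=> [[px ->]|[qz xz]].
  have [u ->] := (pk x).1 px.
  have zE : z (u *m C, 0) = u *m D by rewrite /z /= add0r -mulmxA -DE.
  rewrite zE -mulmxA -CE subrr; congr pair; apply/qk; by exists u.
have [u zE] := (qk _).1 qz.
have xE : x = u *m C.
  by apply/eqP; rewrite -subr_eq0 CE mulmxA -zE; apply/eqP.
congr pair; first by apply/pk; exists u.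
by move: zE; rewrite /z /= xE -mulmxA -DE -[RHS]add0r => /addIr.
Qed.

Lemma presents_pair T T' m n m' n' (A : 'M[R]_(m, n)) (B : 'M[R]_(m', n')) :
  presents T A -> presents T' B -> presents (T * T')%type (block_mx A 0 0 B).
Proof.
move=> [p [pS pk]] [q [qS qk]].
have lf : linear (fun v => (p (lsubmx v), q (rsubmx v)) : (T * T')%type).
  by move=> a x y; rewrite !linearP.
exists (mk_linear lf); split=> [[x y]|v].
  have [a <-] := pS x; have [b <-] := qS y.
  by exists (row_mx a b); rewrite /= row_mxKl row_mxKr.
split=> [[/pk[u uE] /qk[w wE]]|[u ->]].
  exists (row_mx u w).
  by rewrite mul_row_block !mulmx0 addr0 add0r -uE -wE hsubmxK.
rewrite -[u]hsubmxK mul_row_block !mulmx0 addr0 add0r /= row_mxKl row_mxKr.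
by congr pair; [apply/pk; exists (lsubmx u)|apply/qk; exists (rsubmx u)].
Qed.

Lemma presents_unipotentl T m n q (A : 'M[R]_(m, n)) (Y : 'M[R]_(m, q)) :
  presents T A -> presents T (block_mx A Y 0 1%:M : 'M_(m + q, n + q)).
Proof.
move=> [p [pS pk]].
have lf : linear (fun v : 'rV[R]_(n + q) => p (lsubmx v)).
  by move=> a x y; rewrite !linearP.
exists (mk_linear lf); split=> [x|v].
  by have [a <-] := pS x; exists (row_mx a 0); rewrite /= row_mxKl.
split=> [/pk[u uE]|[u ->]].
  exists (row_mx u (rsubmx v - u *m Y)).
  by rewrite mul_row_block mulmx0 addr0 mulmx1 [_ + (_ - _)]addrC subrK -uE hsubmxK.
rewrite -[u]hsubmxK mul_row_block mulmx0 addr0 /= row_mxKl.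
by apply/pk; exists (lsubmx u).
Qed.

Lemma presents_unipotentr T m n q (A : 'M[R]_(m, n)) (Y : 'M[R]_(m, q)) :
  presents T A -> presents T (block_mx 1%:M 0 Y A : 'M_(q + m, q + n)).
Proof.
move=> [p [pS pk]].
have lf : linear (fun v : 'rV[R]_(q + n) => p (rsubmx v)).
  by move=> a x y; rewrite !linearP.
exists (mk_linear lf); split=> [x|v].
  by have [a <-] := pS x; exists (row_mx 0 a); rewrite /= row_mxKr.
split=> [/pk[u uE]|[u ->]].
  exists (row_mx (lsubmx v - u *m Y) u).
  by rewrite mul_row_block mulmx0 add0r mulmx1 subrK -uE hsubmxK.
rewrite -[u]hsubmxK mul_row_block mulmx0 add0r /= row_mxKr.
by apply/pk; exists (rsubmx u).
Qed.

Lemma linear_rows (V : lmodType R) n (f g : {linear 'rV[R]_n -> V}) :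
  (forall j, f (delta_mx 0 j) = g (delta_mx 0 j)) -> f =1 g.
Proof.
move=> fg v; rewrite (row_sum_delta v) !linear_sum; apply: eq_bigr => j _.
by rewrite !linearZ fg.
Qed.

Lemma matrix_of_rows m n (P : 'I_m -> 'rV[R]_n -> Prop) :
  (forall i, exists v, P i v) -> exists X : 'M[R]_(m, n), forall i, P i (row i X).
Proof.
move=> /choice[f fP]; exists (\matrix_i f i) => i; rewrite rowK; exact: fP.
Qed.

(** Two presentations of one module can be enlarged, by elementary operations
    and identity blocks, to have the same row space: that of the relations
    among the generators of both. *)
Lemma presents_common T m n k l (A : 'M[R]_(m, n)) (B : 'M[R]_(k, l)) :
  presents T A -> presents T B ->
  exists (X : 'M[R]_(n, l)) (Y : 'M[R]_(l, n)) E F,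
    let A' : 'M_(m + l, n + l) := block_mx A 0 Y 1%:M in
    let B' : 'M_(n + k, n + l) := block_mx 1%:M X 0 B in
    A' = E *m B' /\ B' = F *m A'.
Proof.
move=> [p [pS pk]] [q [qS qk]].
have [X XP] := matrix_of_rows (fun i => qS (- p (delta_mx 0 i))).
have [Y YP] := matrix_of_rows (fun i => pS (- q (delta_mx 0 i))).
have lX : linear (fun u => q (u *m X)).
  by move=> a x y; rewrite mulmxDl -scalemxAl linearP.
have lY : linear (fun u => p (u *m Y)).
  by move=> a x y; rewrite mulmxDl -scalemxAl linearP.
have qX u : q (u *m X) = - p u.
  have ln : linear (fun u => - p u) by move=> a x y; rewrite linearP opprD scalerN.
  apply: (@linear_rows _ _ (mk_linear lX) (mk_linear ln)) => j /=.
  by rewrite -rowE XP.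
have pY u : p (u *m Y) = - q u.
  have ln : linear (fun u => - q u) by move=> a x y; rewrite linearP opprD scalerN.
  apply: (@linear_rows _ _ (mk_linear lY) (mk_linear ln)) => j /=.
  by rewrite -rowE YP.
have factorB (h : nat) (Z : 'M[R]_(h, l)) :
    (forall u, q (u *m Z) = 0) -> exists U, Z = U *m B.
  move=> qZ; have [|U UP] := @matrix_of_rows h k (fun i u => row i Z = u *m B).
    by move=> i; apply/qk; rewrite rowE.
  by exists U; apply/row_matrixP => i; rewrite UP row_mul.
have factorA (h : nat) (Z : 'M[R]_(h, n)) :
    (forall u, p (u *m Z) = 0) -> exists U, Z = U *m A.
  move=> pZ; have [|U UP] := @matrix_of_rows h m (fun i u => row i Z = u *m A).
    by move=> i; apply/pk; rewrite rowE.
  by exists U; apply/row_matrixP => i; rewrite UP row_mul.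
have [E1 E1P] : exists U, A *m X = U *m B.
  by apply: factorB => u; rewrite mulmxA qX (_ : p _ = 0) ?oppr0 //; apply/pk; exists u.
have [E2 E2P] : exists U, 1%:M - Y *m X = U *m B.
  apply: factorB => u; rewrite mulmxBr mulmx1 linearB mulmxA qX pY opprK.
  by rewrite subrr.
have [F1 F1P] : exists U, 1%:M - X *m Y = U *m A.
  apply: factorA => u; rewrite mulmxBr mulmx1 linearB mulmxA pY qX opprK.
  by rewrite subrr.
have [F2 F2P] : exists U, B *m Y = U *m A.
  by apply: factorA => u; rewrite mulmxA pY (_ : q _ = 0) ?oppr0 //; apply/qk; exists u.
exists X, Y, (block_mx A (- E1) Y E2), (block_mx F1 X (- F2) B); split.
  rewrite mulmx_block !mulmx0 !mulmx1 !addr0 mulNmx -E1P -E2P subrr.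
  by rewrite addrC subrK.
rewrite mulmx_block !mulmx0 !mulmx1 !add0r mulNmx -F1P -F2P subrK.
by rewrite addNr.
Qed.

End Presentations.

Section Transpose.
Variables (R S : pzRingType).

Definition anti_iso (tau : S -> R) (sigma : R -> S) :=
  [/\ cancel tau sigma, cancel sigma tau, {morph tau : x y / x + y}
    & forall x y, tau (x * y) = tau y * tau x].

(** Matrices act on row vectors from the right, so transposition exchanges maps
    of free left modules over S with maps of free left modules over R. *)
Definition star (tau : S -> R) m n (A : 'M[S]_(m, n)) : 'M[R]_(n, m) :=
  (map_mx tau A)^T.

(** The Auslander-Bridger transposes of T are the modules M such that
    transposed T M; they are determined up to free summands. *)
Definition transposed (tau : S -> R) (T : lmodType S) (M : lmodType R) :=
  exists m n (A : 'M[S]_(m, n)), presents T A /\ presents M (star tau A).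

Variables (tau : S -> R) (sigma : R -> S).
Hypothesis tauP : anti_iso tau sigma.

Lemma anti_iso0 : tau 0 = 0.
Proof.
by case: tauP => _ _ tauD _; apply: (addIr (tau 0)); rewrite -tauD !add0r.
Qed.

Lemma anti_iso1 : tau 1 = 1.
Proof.
by case: tauP => _ sK _ tauM; rewrite -[LHS]mulr1 -{1}(sK 1) -tauM mulr1 sK.
Qed.

Lemma anti_iso_sum (I : Type) (r : seq I) (F : I -> S) :
  tau (\sum_(i <- r) F i) = \sum_(i <- r) tau (F i).
Proof. by case: tauP => _ _ tauD _; exact: (big_morph tau tauD anti_iso0). Qed.

Lemma starM m n p (A : 'M[S]_(m, n)) (B : 'M[S]_(n, p)) :
  star tau (A *m B) = star tau B *m star tau A.
Proof.
apply/matrixP => i j; rewrite !mxE anti_iso_sum; apply: eq_bigr => k _.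
by case: tauP => _ _ _ tauM; rewrite !mxE tauM.
Qed.

Lemma star0 m n : star tau (0 : 'M[S]_(m, n)) = 0.
Proof. by apply/matrixP => i j; rewrite !mxE anti_iso0. Qed.

Lemma star1 n : star tau (1%:M : 'M[S]_n) = 1%:M.
Proof.
apply/matrixP => i j; rewrite !mxE eq_sym.
by case: eqP => _; rewrite /= ?anti_iso1 ?anti_iso0.
Qed.

Lemma star_block m1 m2 n1 n2 (A : 'M[S]_(m1, n1)) B C (D : 'M[S]_(m2, n2)) :
  star tau (block_mx A B C D) =
  block_mx (star tau A) (star tau C) (star tau B) (star tau D).
Proof. by rewrite /star map_block_mx tr_block_mx. Qed.

Lemma transposed_isol T T' M : iso T T' -> transposed tau T M -> transposed tau T' M.
Proof.
move=> isoT [m [n [A [TA MA]]]]; exists m, n, A; split=> //.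
exact: presents_iso isoT TA.
Qed.

Lemma transposed_pair T T' M M' : transposed tau T M -> transposed tau T' M' ->
  transposed tau (T * T')%type (M * M')%type.
Proof.
move=> [m [n [A [TA MA]]]] [m' [n' [A' [TA' MA']]]].
exists (m + m')%N, (n + n')%N, (block_mx A 0 0 A'); split.
  exact: presents_pair.
by rewrite star_block !star0; apply: presents_pair.
Qed.

Lemma transposed_stable_iso T M M' : transposed tau T M -> transposed tau T M' ->
  exists k l, iso (M * 'rV[R]_k)%type (M' * 'rV[R]_l)%type.
Proof.
move=> [m [n [A [TA MA]]]] [m' [n' [B [TB MB]]]].
have [X [Y [E [F [AE BF]]]]] := presents_common TA TB.
exists (n + m')%N, (m + n')%N.
have := congr1 (@star tau _ _) AE; have := congr1 (@star tau _ _) BF.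
rewrite !starM => BE' AE'; apply: (stable_iso_same_columns AE' BE').
- by rewrite star_block star0 star1; apply: presents_unipotentl.
- by rewrite star_block star0 star1; apply: presents_unipotentr.
Qed.

End Transpose.

Lemma anti_iso_sym R S tau sigma : @anti_iso R S tau sigma -> anti_iso sigma tau.
Proof.
move=> [tK sK tauD tauM]; split=> // x y; apply: (can_inj tK).
  by rewrite tauD !sK.
by rewrite tauM !sK.
Qed.

Lemma transposed_sym R S tau sigma T M : @anti_iso R S tau sigma ->
  transposed tau T M -> transposed sigma M T.
Proof.
move=> [tK _ _ _] [m [n [A [TA MA]]]]; exists n, m, (star tau A); split=> //.
suff -> : star sigma (star tau A) = A by [].
by apply/matrixP => i j; rewrite !mxE tK.
Qed.

(** * Graded transposes *)

Lemma fg_pair (R : pzRingType) (M N : lmodType R) :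
  finitely_generated M -> finitely_generated N -> finitely_generated (M * N)%type.
Proof.
move=> /finitely_generatedP[s sP] /finitely_generatedP[t tP].
apply/finitely_generatedP; exists (map injl s ++ map injr t) => x.
have sS := submod_span (map injl s ++ map injr t : seq (M * N)%type).
rewrite [x]pair_inj; apply: submodD => //.
  apply: (span_subset (submod_preimage injl sS) _ (sP (projl x))) => y ys.
  by apply: mem_span; rewrite mem_cat map_f.
apply: (span_subset (submod_preimage injr sS) _ (tP (projr x))) => y yt.
by apply: mem_span; rewrite mem_cat map_f ?orbT.
Qed.

Definition within (R : pzRingType) (Rg : int -> set R) (M : gradedModule Rg)
    (c L : int) :=
  forall k x, gcomp M k x -> x <> 0 -> (c <= k < c + L)%R.

Lemma row_neq0 (R : pzRingType) n (v : 'rV[R]_n) : v <> 0 -> exists j, v 0 j <> 0.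
Proof.
move=> v0; apply: contrapT => nov; apply: v0; apply/rowP => j.
by rewrite mxE; apply: contrapT => vj; apply: nov; exists j.
Qed.

Section GradedTranspose.
Variables (R S : pzRingType) (Rg : int -> set R) (Sg : int -> set S).
Hypotheses (gradedR : is_graded_ring Rg) (gradedS : is_graded_ring Sg).
Variable tau : S -> R.
Hypothesis tau_comp : forall n s, Sg n s -> Rg n (tau s).
Hypothesis artS : left_artinian S.

(** The transpose of a homogeneous presentation matrix is homogeneous, for the
    opposite degrees of the generators and relations. When T lives in a window
    of length b, the generators have their degrees in it, the relations in a
    window larger by l on both sides, and each generator of the transpose has
    degree opposite to a relation and reaches l further on both sides. *)
Lemma graded_transpose (T : gradedModule Sg) : finitely_generated T ->
  exists M : gradedModule Rg,
    [/\ finitely_generated M, transposed tau T M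
      & forall l c b : int,
          (forall k s, Sg k s -> s <> 0 -> - l <= k <= l) ->
          (forall k r, Rg k r -> r <> 0 -> - l <= k <= l) ->
          within T c b -> exists c', within M c' (b + 4 * l)].
Proof.
move=> fgT.
have [n [d [g [gT g0 gP]]]] : exists n (d : 'I_n -> int) (g : 'I_n -> T),
    [/\ forall j, gcomp T (d j) (g j), forall j, g j <> 0
      & forall x, setT x <-> exists v, x = comb g v].
  apply: homogeneous_generators; first by split; [exact: submodT|].
  by apply: noetherian_fg => //; exact: submodT.
pose F := gfree gradedS d; pose p : {linear F -> T} := comb g.
have pg : graded_morphism p.
  move=> k v; rewrite !inE => Fv; rewrite /p /= /comb.
  elim/big_ind: _ => [|x y Tx Ty|j _]; first exact: gr_comp0 (gmoduleP T).1 k.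
    exact: gr_compD (gmoduleP T).1 _ _ _ Tx Ty.
  by have := gcomp_scale (Fv j) (gT j); rewrite addrC subrK.
have [m [a [h [hF h0 hP]]]] : exists m (a : 'I_m -> int) (h : 'I_m -> F),
    [/\ forall j, gcomp F (a j) (h j), forall j, h j <> 0
      & forall x, [set x | p x = 0] x <-> exists v, x = comb h v].
  apply: homogeneous_generators; first exact: gsubmod_ker.
  by apply: noetherian_fg => //; [exact: fg_rV|exact: submod_ker].
pose A : 'M[S]_(m, n) := \matrix_i (h i : 'rV_n).
have TA : presents T A.
  exists p; split=> [x|v].
    by have [v ->] := (gP x).1 Logic.I; exists v.
  have combE u : comb h u = u *m A.
    by rewrite mulmx_sum_row; apply: eq_bigr => i _; rewrite rowK.
  by split=> [/hP[u ->]|[u ->]]; [exists u|apply/hP; exists u].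
pose G := gfree gradedR (fun i => - a i); pose G' := gfree gradedR (fun j => - d j).
have lq : linear (fun v : G' => v *m star tau A : G).
  by move=> c x y; rewrite mulmxDl -scalemxAl.
have qg : graded_morphism (mk_linear lq).
  move=> k v; rewrite !inE => Gv i; rewrite mxE.
  elim/big_ind: _ => [|x y Rx Ry|j _]; first exact: gr_comp0 gradedR.1 _.
    exact: gr_compD gradedR.1 _ _ _ Rx Ry.
  have -> : k - - a i = (k - - d j) + (a i - d j).
    by rewrite !opprK [a i - _]addrC addrA addrK.
  apply: (mul_comp gradedR) => //; rewrite !mxE; apply: tau_comp.
  exact: hF.
have [M [r [rg rS rk]]] := gquotient_ex (gsubmod_range qg).
have MA : presents M (star tau A).
  exists r; split=> // v; rewrite rk; split; first by case=> u _ <-; exists u.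
  by case=> u ->; exists u.
exists M; split; first exact: fg_image rS (fg_rV _ _).
  by exists m, n, A.
move=> l c b Sl Rl Tcb.
have db j : c <= d j < c + b by apply: Tcb (gT j) (g0 j).
have ab i : c - l <= a i < c + b + l.
  have [j hj] := row_neq0 (h0 i); have := Sl _ _ (hF i j) hj.
  by have := db j; lia.
exists (1 - c - b - 2 * l) => k x Mx x0.
have [v vx] := rS x.
have xE : r (hproj k v) = x.
  by rewrite -(graded_morphismP r).1 // vx /hproj (gr_proj_id _ Mx).
have [i vi] : exists i, (hproj k v : 'rV[R]_m) 0 i <> 0.
  by apply: row_neq0 => v0; apply: x0; rewrite -xE v0 linear0.
have Gv : gcomp G k (hproj k v) by apply: gr_proj_mem.
by have := Rl _ _ (Gv i) vi; have := ab i; lia.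
Qed.

End GradedTranspose.

(** * Graded lengths *)

Section Length.
Variables (R : pzRingType) (Rg : int -> set R).
Implicit Types M : gradedModule Rg.

Lemma degreeP M n : gcomp M n <> [set 0] <-> exists2 x, gcomp M n x & x <> 0.
Proof.
split=> [Mn|[x Mx x0] Mn]; last by move: Mx; rewrite Mn.
apply: contrapT => nox; apply: Mn; apply/seteqP; split=> x.
  by move=> Mx; apply: contrapT => x0; apply: nox; exists x.
by move=> ->; apply: gr_comp0 (gmoduleP M).1 n.
Qed.

Lemma int_set_max (D : set int) k0 r : D k0 -> (forall k, D k -> k <= r) ->
  exists m, D m /\ forall k, D k -> k <= m.
Proof.
move=> Dk0 Dr.
have ex : exists n : nat, `[< D (r - n%:Z) >].
  exists `|r - k0|%N; apply/asboolP; rewrite (_ : r - _ = k0) //.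
  by have := Dr _ Dk0; lia.
case: (ex_minnP ex) => n /asboolP Dn minn; exists (r - n%:Z); split=> // k Dk.
have := Dr _ Dk; have := minn `|r - k|%N.
have -> : r - `|r - k|%N%:Z = k by have := Dr _ Dk; lia.
by move=> /(_ (asboolT Dk)); lia.
Qed.

(** The supremum is the maximum, or +oo when there is no upper bound in int. *)
Lemma supremum_int (D : set int) k0 : D k0 ->
  supremums (EFin @` D) (supremum -oo%E (EFin @` D)).
Proof.
move=> Dk0; rewrite /supremum ifN; last by apply/set0P; exists k0%:E%E; exists k0.
apply: xgetPex.
have [[r rP]|nob] := pselect (exists r, forall k, D k -> k <= r).
  have [m [Dm mP]] := int_set_max Dk0 rP.
  exists m%:E%E; split=> [_ [k Dk <-]|y]; first by rewrite lee_fin mP.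
  by apply; exists m.
exists +oo%E; split=> [y _|[r|//|] ub]; first by rewrite leey.
  by case: nob; exists r => k Dk; have := ub _ (imageP EFin Dk); rewrite lee_fin.
by have := ub _ (imageP EFin Dk0); rewrite leeNy_eq.
Qed.

Lemma infimum_int (D : set int) k0 : D k0 ->
  infimums (EFin @` D) (infimum +oo%E (EFin @` D)).
Proof.
move=> Dk0; rewrite /infimum ifN; last by apply/set0P; exists k0%:E%E; exists k0.
apply: xgetPex.
have [[r rP]|nob] := pselect (exists r, forall k, D k -> r <= k).
  have [||m [Dm mP]] := @int_set_max [set k | D (- k)] (- k0) (- r).
  - by rewrite /= opprK.
  - by move=> k /= /rP; rewrite lerNr.
  exists (- m)%:E%E; split=> [_ [k Dk <-]|y]; last by apply; exists (- m).
  by rewrite lee_fin lerNl; apply: mP; rewrite /= opprK.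
exists -oo%E; split=> [y _|[r||//] lb]; first by rewrite leNye.
  by case: nob; exists r => k Dk; have := lb _ (imageP EFin Dk); rewrite lee_fin.
by have := lb _ (imageP EFin Dk0); rewrite leye_eq.
Qed.

(** This bound holds also for modules in infinitely many degrees, whose graded
    length is +oo. *)
Lemma graded_length_ge M i j x y :
  gcomp M i x -> x <> 0 -> gcomp M j y -> y <> 0 ->
  ((j - i + 1)%:E <= graded_length M)%E.
Proof.
move=> Mx x0 My y0.
have Di : [set n | gcomp M n <> [set 0]] i by apply/degreeP; exists x.
have Dj : [set n | gcomp M n <> [set 0]] j by apply/degreeP; exists y.
have [ub _] := supremum_int Dj; have [lb _] := infimum_int Di.
rewrite /graded_length EFinD; apply: leeD => //.
rewrite EFinB; apply: leeB; first by apply: ub; exists j.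
by apply: lb; exists i.
Qed.

Lemma graded_length_le M c L : ~ zero_module M -> within M c L ->
  (graded_length M <= L%:E)%E.
Proof.
move=> M0 Mc.
have [k0 Dk0] : exists k, [set n | gcomp M n <> [set 0]] k.
  apply: contrapT => noD; apply: M0.
  apply: (homogeneous_ind (gmoduleP M).1) => // [x y -> ->|n x Mx]; first by rewrite addr0.
  by apply: contrapT => x0; apply: noD; exists n; apply/degreeP; exists x.
have [_ lub] := supremum_int Dk0; have [_ glb] := infimum_int Dk0.
have -> : L%:E%E = ((c + L - 1)%:E - c%:E + 1)%E :> \bar int.
  by rewrite -EFinB -EFinD; congr EFin; lia.
rewrite /graded_length; apply: leeD => //; apply: leeB.
  by apply: lub => _ [k /degreeP[x Mx x0] <-]; rewrite lee_fin; have := Mc _ _ Mx x0; lia.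
by apply: glb => _ [k /degreeP[x Mx x0] <-]; rewrite lee_fin; have := Mc _ _ Mx x0; lia.
Qed.

Lemma within_length M (b : nat) : ~ zero_module M ->
  (graded_length M <= (b%:Z)%:E)%E -> exists c, within M c (2 * b%:Z).
Proof.
move=> M0 lenM; apply: contrapT => noc; apply: M0.
apply: (homogeneous_ind (gmoduleP M).1) => // [x y -> ->|n x Mx]; first by rewrite addr0.
apply: contrapT => x0; apply: noc; exists (n - b%:Z) => k y My y0.
have := le_trans (graded_length_ge Mx x0 My y0) lenM.
have := le_trans (graded_length_ge My y0 Mx x0) lenM.
by rewrite !lee_fin; lia.
Qed.

End Length.

(** * Gradability and bounds on graded lengths are left-right symmetric *)

Section OneSide.
Variables (R S : pzRingType) (Rg : int -> set R) (Sg : int -> set S).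
Hypotheses (gradedR : is_graded_ring Rg) (gradedS : is_graded_ring Sg).
Variables (tau : S -> R) (sigma : R -> S).
Hypothesis tauP : anti_iso tau sigma.
Hypothesis tau_comp : forall n s, Sg n s -> Rg n (tau s).
Hypothesis sigma_comp : forall n r, Rg n r -> Sg n (sigma r).
Hypotheses (artR : left_artinian R) (artS : left_artinian S).

(** The trivial gradings of R and S turn the graded transpose into an ordinary
    one. *)
Lemma transposed_ex (M : lmodType R) : finitely_generated M ->
  exists T : lmodType S, finitely_generated T /\ transposed tau T M.
Proof.
move=> fgM; have sigmaP := anti_iso_sym tauP.
have [|T [fgT MT _]] := graded_transpose (triv_graded_ring S)
    (triv_graded_ring R) (tau := sigma) _ artR (fgM : finitely_generated (triv_module M)).
  move=> n r /triv_compE[->|->]; apply/triv_compE; first by left.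
  by right; rewrite (anti_iso0 sigmaP).
by exists T; split=> //; apply: transposed_sym sigmaP MT.
Qed.

(** M and the graded transpose of its gradable transpose agree up to free
    summands. *)
Lemma gradable_transfer :
  (forall T : lmodType S, finitely_generated T -> gradable Sg T) ->
  forall M : lmodType R, finitely_generated M -> gradable Rg M.
Proof.
move=> gradS M fgM; have [T [fgT TM]] := transposed_ex fgM.
have [T' isoT] := gradS T fgT.
have fgT' : finitely_generated T'.
  by have [f /bij_surj fS] := isoT; apply: fg_image fS fgT.
have [M' [fgM' TM' _]] := graded_transpose gradedR gradedS tau_comp artS fgT'.
have [k [l isoM]] := transposed_stable_iso tauP (transposed_isol isoT TM) TM'.
pose P : gradedModule Rg := gfree gradedR (fun _ : 'I_k => 0).
pose X := graded_dsum M' (gfree gradedR (fun _ : 'I_l => 0)).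
apply: (gradable_summand gradedR artR (P := P) (X := X)).
- exact: fg_rV.
- exact: fg_pair fgM' (fg_rV R l).
- exact: iso_trans (iso_pairC _ _) isoM.
Qed.

Section Bound.
Variable L : int.

(** For an r such that r o i is the identity this bounds the indecomposable
    summands of N, up to shifts. Only the degree 0 part of r o i is required to
    be invertible, as this is additive over the summands of N. *)
Definition bounded_summands (N : gradedModule Rg) :=
  forall (M : gradedModule Rg) (i : {linear M -> N}) (r : {linear N -> M}),
    finitely_generated M -> graded_indecomposable M ->
    bijective (hcomp gradedR (r \o i) 0) -> exists c, within M c L.

(** The degree 0 part of r o i is a sum of composites of homogeneous maps, one
    of which is invertible; its first factor embeds a shift of M into N. *)
Lemma bounded_summands_within N c : within N c L -> bounded_summands N.
Proof.
move=> Nc M i r fgM indM b.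
have [s sE] := hcomp_comp gradedR i r fgM.
have gr n : graded_morphism (hcomp gradedR r (- n) \o hcomp gradedR i n).
  move=> k x; rewrite !inE => Mx.
  by have := hcomp_mem gradedR r (- n) (hcomp_mem gradedR i n Mx); rewrite addrK.
have [n nb] := graded_local_sum artR fgM indM gr (hcomp0_graded gradedR (r \o i)) b sE.
exists (c - n) => k x Mx x0.
have ix0 : hcomp gradedR i n x <> 0.
  by move=> ix0; apply: x0; apply: (bij_inj nb); rewrite linear0 /= ix0 linear0.
by have := Nc _ _ (hcomp_mem gradedR i n Mx) ix0; lia.
Qed.

Lemma bounded_summands_dsum N1 N2 :
  bounded_summands N1 -> bounded_summands N2 -> bounded_summands (graded_dsum N1 N2).
Proof.
move=> b1 b2 M i r fgM indM b.
pose i1 : {linear M -> N1} := projl \o i; pose i2 : {linear M -> N2} := projr \o i.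
pose r1 : {linear N1 -> M} := r \o injl; pose r2 : {linear N2 -> M} := r \o injr.
have sE x : hcomp gradedR (r \o i) 0 x =
    hcomp gradedR (r1 \o i1) 0 x + hcomp gradedR (r2 \o i2) 0 x.
  have ls : linear (fun x =>
      hcomp gradedR (r1 \o i1) 0 x + hcomp gradedR (r2 \o i2) 0 x).
    by move=> a y z; rewrite !linearP scalerDr addrACA.
  move: x; apply: (@eq_homogeneous _ _ M M _ (mk_linear ls)) => k x Mx /=.
  rewrite !(hcompE _ _ _ Mx) /hproj -gr_projD; congr (gr_proj _ _ _).
  by rewrite /= -linearD -pair_inj.
have [] := graded_local artR fgM indM (hcomp0_graded gradedR (r1 \o i1))
  (hcomp0_graded gradedR (r2 \o i2)) (hcomp0_graded gradedR (r \o i)) b sE.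
  exact: b1.
exact: b2.
Qed.

End Bound.

(** For T the ring itself, this bounds its support: it is a direct sum of
    indecomposable graded modules, which have bounded graded lengths. *)
Lemma bounded_support : bounded_graded_lengths Sg ->
  forall T : gradedModule Sg, finitely_generated T ->
    exists l : nat, within T (- l%:Z) (2 * l%:Z + 1).
Proof.
move=> [b bP]; apply: (graded_decomposition_ind artS) => [T T0|T fgT indT|].
- by exists 0%N => k x _ x0; case: x0; apply: T0.
- have [c Tc] := within_length indT.1 (bP T fgT indT).
  by exists (`|c| + 2 * b)%N => k x Tx x0; have := Tc k x Tx x0; lia.
move=> T T1 T2 [f [g [fg _ fK _]]] [l1 T1l] [l2 T2l].
exists (l1 + l2)%N => k x Tx x0.
have := fg k x; rewrite !inE => /(_ Tx) []; rewrite !inE => fx1 fx2.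
have [fx10|fx1n] := pselect ((f x).1 = 0); last by have := T1l _ _ fx1 fx1n; lia.
have [fx20|fx2n] := pselect ((f x).2 = 0); last by have := T2l _ _ fx2 fx2n; lia.
by case: x0; apply: (can_inj fK); rewrite linear0; apply: injective_projections.
Qed.

(** M is a summand, up to free modules, of a transpose of its transpose T. The
    latter can be computed on the indecomposable summands of T, which have
    bounded graded lengths, and so then do their transposes. *)
Lemma bounded_graded_lengths_transfer :
  bounded_graded_lengths Sg -> bounded_graded_lengths Rg.
Proof.
move=> bS; have [b bP] := bS.
have [l Sl] : exists l : nat, forall k s, Sg k s -> s <> 0 -> - l%:Z <= k <= l%:Z.
  pose F := gfree gradedS (fun _ : 'I_1 => 0).
  have [l Fl] := bounded_support bS (fg_rV S 1 : finitely_generated F).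
  exists l => k s Ss s0; suff : - l%:Z <= k < - l%:Z + (2 * l%:Z + 1) by lia.
  apply: (Fl k (const_mx s)); first by move=> j; rewrite mxE subr0.
  by move/rowP/(_ 0); rewrite !mxE.
have Rl k r : Rg k r -> r <> 0 -> - l%:Z <= k <= l%:Z.
  move=> Rr r0; apply: Sl (sigma_comp Rr) _ => sr0.
  have [_ sK _ _] := tauP.
  by apply: r0; rewrite -(sK r) sr0 (anti_iso0 tauP).
pose L : int := 2 * b%:Z + 4 * l%:Z + 1.
pose Phi (T : gradedModule Sg) :=
  exists N : gradedModule Rg, transposed tau T N /\ bounded_summands L N.
have Phi_within (T : gradedModule Sg) c : finitely_generated T ->
    within T c (2 * b%:Z) -> Phi T.
  move=> fgT Tc.
  have [N [_ TN Nw]] := graded_transpose gradedR gradedS tau_comp artS fgT.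
  have [c' Nc'] := Nw _ _ _ Sl Rl Tc; exists N; split=> //.
  apply: (@bounded_summands_within _ _ c') => k x Nx x0.
  by have := Nc' k x Nx x0; rewrite /L; lia.
have PhiT : forall T : gradedModule Sg, finitely_generated T -> Phi T.
  apply: (graded_decomposition_ind artS) => [T T0|T fgT indT|].
  - apply: (@Phi_within T 0); last by move=> k x _ x0; case: x0; apply: T0.
    by apply/finitely_generatedP; exists [::] => x; apply: T0.
  - have [c Tc] := within_length indT.1 (bP T fgT indT).
    exact: Phi_within Tc.
  move=> T T1 T2 [f [g [_ _ fK gK]]] [N1 [TN1 bN1]] [N2 [TN2 bN2]].
  exists (graded_dsum N1 N2); split; last exact: bounded_summands_dsum.
  apply: transposed_isol (transposed_pair tauP TN1 TN2).
  by exists g; exists f.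
exists `|L|%N => M fgM indM.
have sigmaP := anti_iso_sym tauP.
have [T [fgT MT _]] := graded_transpose gradedS gradedR sigma_comp artR fgM.
have TM := transposed_sym sigmaP MT.
have [N [TN bN]] := PhiT T fgT.
have [k [m [f fb]]] := transposed_stable_iso tauP TM TN.
have [g [fK gK]] := linear_bij_inv fb.
pose F := gfree gradedR (fun _ : 'I_m => 0).
have bF : bounded_summands L F.
  apply: (@bounded_summands_within _ _ (- l%:Z)) => n v Fv /row_neq0[j vj].
  by have := Rl _ _ (Fv j) vj; rewrite subr0 /L; lia.
pose i : {linear M -> graded_dsum N F} := f \o injl.
pose r : {linear graded_dsum N F -> M} := projl \o g.
have [|c Mc] := bounded_summands_dsum bN bF (i := i) (r := r) fgM indM.
  apply: (eq_bij (inv_bij (fun=> erefl))).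
  by apply/fsym/hcomp0_id => x; rewrite /= fK.
have -> : (`|L|%N%:Z) = L by rewrite /L; lia.
exact: graded_length_le indM.1 Mc.
Qed.

End OneSide.

Theorem corollary5p3 (R : pzRingType) (Rg : int -> set R)
    (gradedR : is_graded_ring Rg)
    (lartR : left_artinian R) (rartR : right_artinian R) :
  ((forall M : lmodType R^c, finitely_generated M -> @gradable R^c Rg M) <->
   (forall M : lmodType R, finitely_generated M -> @gradable R Rg M)) /\
  (@bounded_graded_lengths R^c Rg <-> @bounded_graded_lengths R Rg).
Proof.
have gradedRc : @is_graded_ring R^c Rg.
  have [gR mR] := gradedR; split=> // i j r s ri sj.
  by rewrite addrC; apply: (mR j i s r).
have to_R : @anti_iso R R^c id id by split.
have to_Rc : @anti_iso R^c R id id by split.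
have idc (n : int) (x : R) : Rg n x -> Rg n (id x) by [].
split; split.
- exact: (gradable_transfer gradedR gradedRc to_R idc lartR rartR).
- exact: (gradable_transfer gradedRc gradedR to_Rc idc rartR lartR).
- exact: (bounded_graded_lengths_transfer gradedR gradedRc to_R idc idc lartR rartR).
- exact: (bounded_graded_lengths_transfer gradedRc gradedR to_Rc idc idc rartR lartR).
Qed.
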